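(* Let $N$ be the marked Hawkes process described in the context, and assume $\|F\|_{L^1}<1$ and $\int_0^\infty tF(t)\,dt<\infty$. Let $\varphi:\mathcal X\to\mathbb R$ be a bounded Borel function, and define $$D^\varphi_t=\int_{(0,t]}\int_{\mathcal X}\varphi(x)\,N(ds,dx)=\sum_{n=1}^{N(t)}\varphi(X_n),\quad t\ge0,\qquad \varphi_{\mathbb Q}=\int_{\mathcal X}\varphi(x)\,\mathbb Q(dx).$$ Assume that $$\int_{\mathcal X}\left[\int_0^\infty\left(f(u,x)+\int_0^u R(u-r)f(r,x)\,dr\right)du\right]^2\mathbb Q(dx)<\infty .$$ Put $\psi(v)=\varphi_{\mathbb Q}\,v\,m\,(\|R\|_{L^1}+1)$ for $v\ge0$. Then the family of processes $\{(T^{-1}D^\varphi_{vT})_{T\ge0},\ v\ge0\}$ converges to $\psi$ point-wise in probability as $T\to\infty$; that is, for each $v\ge0$, $$\frac{D^\varphi_{vT}}{T}\longrightarrow\psi(v)\quad\text{in probability as }T\to\infty .$$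
   Context: Setting. $(\Omega,\mathcal F,\mathbb P)$ is a probability space and $(\mathcal X,\boldsymbol{\mathcal X})$ is a Borel space; $\partial$ is a point external to $\mathcal X$. A marked point process with mark space $\mathcal X$ is a sequence $N=((T_n,X_n))_{n\ge1}$ of random elements, where $T_n$ takes values in $(0,\infty]$, $X_n$ takes values in $\mathcal X\cup\{\partial\}$, $T_n\le T_{n+1}$, with $T_n<T_{n+1}$ if $T_n<\infty$, and $X_n=\partial$ iff $T_n=\infty$. It is identified with the integer-valued random measure $N(dt,dx)=\sum_{n\ge1}\delta_{(T_n,X_n)}(dt,dx)\mathbf 1_{\{T_n<\infty\}}$ on $\mathbb R_+\times\mathcal X$. $N$ is a marked Hawkes process: with respect to the natural filtration of $N$, the compensator of the random measure $N$ is $\kappa(t,dx)\,dt$, where $$\kappa(t,A)=\Big(m+\int_{(0,t)\times\mathcal X}f(t-s,x)\,N(ds,dx)\Big)\mathbb Q(A),\qquad t\ge0,\ A\in\boldsymbol{\mathcal X}.$$ Here $\mathbb Q$ is a probability measure on $(\mathcal X,\boldsymbol{\mathcal X})$, $m\ge0$ is a constant, and $f:\mathbb R_+\times\mathcal X\to\mathbb R_+$ is non-negative, bounded and measurable with $\int_{\mathcal X}\|f(\cdot,x)\|_{L^1}^2\,\mathbb Q(dx)<\infty$, where $L^1=L^1(\mathbb R_+)$. Notation. $N(t)=N((0,t],\mathcal X)$. $F(t)=\int_{\mathcal X}f(t,x)\,\mathbb Q(dx)$ for $t\ge0$. Convolution is $g\ast h(t)=\int_0^t g(t-s)h(s)\,ds$.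 $R=-r$, where $r$ is the unique solution (resolvent of $-F$) of $r(t)=F\ast r(t)-F(t)$, $t\ge0$; equivalently $R=F+F\ast R$ and $R=\sum_{n\ge1}F_n$ with $F_1=F$, $F_{n+1}=F_n\ast F$. Convention: $0/0=0$. *)

(* Defs.v *)
From HB Require Import structures.
From mathcomp Require Import all_boot all_order all_algebra.
From mathcomp Require Import all_classical all_reals all_analysis.
From mathcomp Require Import measurable_realfun.
Set Implicit Arguments.
Unset Strict Implicit.
Unset Printing Implicit Defensive.
Import Order.TTheory GRing.Theory Num.Theory numFieldNormedType.Exports.

Local Open Scope classical_set_scope.
Local Open Scope ring_scope.

(* Borel isomorphic to a Borel subset of [0, 1]. *)
Definition borel_space (R : realType) (d : measure_display)
    (X : measurableType d) : Prop :=
  exists g : X -> measurableTypeR R,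
    [/\ injective g,
        range g `<=` `[0, 1]%classic,
        measurable_fun setT g &
        forall A : set X, measurable A -> measurable (g @` A)].

(* The point external to the mark space X is None : option X; a subset B of
   option X is measurable when its trace Some @^-1` B on X is.
   Sequences are indexed from 0 instead of 1. *)
Record marked_point_process (R : realType) (d dX : measure_display)
    (Omega : measurableType d) (X : measurableType dX)
    (T : nat -> Omega -> \bar R) (M : nat -> Omega -> option X) : Prop := {
  mpp_time_measurable : forall n, measurable_fun setT (T n) ;
  mpp_mark_measurable : forall n (B : set (option X)),
    measurable (Some @^-1` B) -> measurable (M n @^-1` B) ;
  mpp_time_gt0 : forall n w, (0 < T n w)%E ;
  mpp_time_le : forall n w, (T n w <= T n.+1 w)%E ;
  mpp_time_lt : forall n w, (T n w < +oo)%E -> (T n w < T n.+1 w)%E ;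
  mpp_mark_none : forall n w, M n w = None <-> T n w = +oo%E }.

Section point_measure.
Context (R : realType) (dX : measure_display) (X : measurableType dX).

Definition point_mass (t : \bar R) (x : option X) :
    {measure set (measurableTypeR R * X) -> \bar R} :=
  match t, x with
  | r%:E%E, Some y => @dirac _ (measurableTypeR R * X)%type (r, y) R
  | _, _ => mzero
  end.

(* The value at w of the random measure identified with ((T_n, M_n))_n. *)
Definition point_measure (Omega : Type) (T : nat -> Omega -> \bar R)
    (M : nat -> Omega -> option X) (w : Omega) :
    {measure set (measurableTypeR R * X) -> \bar R} :=
  mseries (fun n => point_mass (T n w) (M n w)) 0.

End point_measure.

Section compensator.
Context (R : realType) (d dX : measure_display).
Context (Omega : measurableType d) (X : measurableType dX).

Definition natural_filtration
    (N : Omega -> {measure set (measurableTypeR R * X) -> \bar R})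
    (t : R) : set (set Omega) :=
  <<s [set C | exists s (A : set X) (B : set (\bar R)),
        [/\ 0 <= s <= t, measurable A, measurable B &
            C = (fun w => N w (`]0, s]%classic `*` A)) @^-1` B]] >>.

(* Predictable sigma-field on Omega x R_+. *)
Definition predictable (Fil : R -> set (set Omega)) : set (set (Omega * R)) :=
  <<s setT `*` `[0, +oo[%classic,
      [set C | (exists2 G, Fil 0 G & C = G `*` [set 0]) \/
               (exists s t G, [/\ 0 <= s, s < t, Fil s G &
                                  C = G `*` `]s, t]%classic])] >>.

(* Its product with the sigma-field of X, on (Omega x R_+) x X. *)
Definition predictable_marked (Fil : R -> set (set Omega)) :
    set (set (Omega * R * X)) :=
  <<s (setT `*` `[0, +oo[%classic) `*` setT,
      [set C | exists B (A : set X),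
        [/\ predictable Fil B, measurable A & C = B `*` A]] >>.

(* With respect to the filtration Fil, the random measure N on R_+ x X has
   compensator kappa(t, dx) dt. *)
Definition has_compensator_kernel (P : probability Omega R)
    (Fil : R -> set (set Omega))
    (N : Omega -> {measure set (measurableTypeR R * X) -> \bar R})
    (kappa : Omega -> R -> {measure set X -> \bar R}) : Prop :=
  (forall (A : set X) (B : set (\bar R)), measurable A -> measurable B ->
     predictable Fil [set z | 0 <= z.2 /\ B (kappa z.1 z.2 A)]) /\
  (forall H : Omega -> R -> X -> \bar R,
     (forall w t x, 0 <= t -> (0 <= H w t x)%E) ->
     (forall B : set (\bar R), measurable B ->
        predictable_marked Fil
          [set z | 0 <= z.1.2 /\ B (H z.1.1 z.1.2 z.2)]) ->
     (\int[P]_w \int[N w]_(z in `[0%R, +oo[%classic `*` setT) H w z.1 z.2 =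
      \int[P]_w \int[lebesgue_measure]_(t in `[0%R, +oo[)
                  \int[kappa w t]_x H w t x)%E).

End compensator.

Section half_line.
Context (R : realType).

Definition L1_norm (g : R -> R) : \bar R :=
  (\int[lebesgue_measure]_(t in `[0%R, +oo[) `|(g t)%:E|)%E.

Definition convol (g h : R -> R) (t : R) : R :=
  \int[lebesgue_measure]_(s in `[0, t]) (g (t - s) * h s).

(* r is the resolvent of - F. Local integrability is the class in which the
   equation has at most one solution on R_+. *)
Definition resolvent_opp (F r : R -> R) : Prop :=
  (forall t, 0 <= t ->
     (@lebesgue_measure R).-integrable `[0, t] (EFin \o r)) /\
  (forall t, 0 <= t -> r t = convol F r t - F t).

End half_line.

(* Marked Hawkes process with baseline m, excitation function f and mark
   distribution Q. *)
Definition marked_hawkes (R : realType) (d dX : measure_display)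
    (Omega : measurableType d) (X : measurableType dX)
    (P : probability Omega R) (Q : probability X R) (m : R) (f : R -> X -> R)
    (T : nat -> Omega -> \bar R) (M : nat -> Omega -> option X) : Prop :=
  marked_point_process T M /\
  exists2 kappa : Omega -> R -> {measure set X -> \bar R},
    has_compensator_kernel P (natural_filtration (point_measure T M))
      (point_measure T M) kappa &
    forall w t (A : set X), 0 <= t -> measurable A ->
      (kappa w t A =
       (m%:E + \int[point_measure T M w]_(z in `]0%R, t[%classic `*` setT)
                 (f (t - z.1)%R z.2)%:E) * Q A)%E.

Definition cvg_in_probability (R : realType) (d : measure_display)
    (Omega : measurableType d) (P : probability Omega R)
    (Y : R -> Omega -> R) (c : R) : Prop :=
  forall eps : R, 0 < eps ->
    P [set w | eps <= `|Y S w - c|] @[S --> +oo] --> 0%E.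

(* Main.v *)
Require Import Defs.
From HB Require Import structures.
From mathcomp Require Import all_boot all_order all_algebra.
From mathcomp Require Import all_classical all_reals all_analysis.
From mathcomp Require Import measurable_realfun ring lra.
Import Order.TTheory GRing.Theory Num.Theory numFieldNormedType.Exports.
Local Open Scope classical_set_scope.
Local Open Scope ring_scope.
Set Implicit Arguments.
Unset Strict Implicit.
Unset Printing Implicit Defensive.

(** Write rho = |F|_1 and let Lambda be the integrated intensity.  For h >= 0 on
    the marks, D^h - h_Q Lambda is a martingale whose second moment at time t is
    (h^2)_Q E [Lambda_t] = O(t), so D^h_t = h_Q Lambda_t + o(t).  Integrating the
    intensity gives Lambda_t = m t + D^g_t - E_t, where g(x) = |f(., x)|_1 has
    mean g_Q = rho and E_t is the excitation that the points up to t produce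
    after t; the moment condition on F makes E [E_t] bounded.  Hence
    (1 - rho) Lambda_t = m t + o(t), so D^phi_t / t tends to phi_Q m / (1 - rho),
    and |R|_1 + 1 = 1 / (1 - rho) by integrating R = F + F * R.

    Everything is done for the process stopped at its n-th point, whose
    intensity is bounded because f is; there the renewal inequality
    b(u) <= m + (F * b)(u) for the mean intensity b gives b <= m / (1 - rho)
    uniformly in n, and n is finally taken of order t^2. *)

(** The compensator is available only as an equality of expectations for non-negative predictable
    integrands. No stochastic integral or stopping theorem is used: each moment comes from one
    choice of integrand, h(x)^2 + 2 h(x) D_{s-} for E [D^2] and lam(s0) 1_{s0 < s} h(x) for E
    [D Lambda], and much of the work is to show that these are predictable for a sigma-field given
    by generators. Cancelling moments requires finite ones; this is what stopping at T_n provides,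
    the intensity being then at most m + (n + 1) C. Three functions h occur: g, for the balance of
    Lambda; phi + K, non-negative when K bounds |phi|; and 1, which removes K again. Since P (T_n <=
    t) = O(t / n), the choice n ~ t^2 gives every exceptional event probability O(1 / t). For the
    resolvent r neither a sign nor integrability over the whole half-line is given; both come from a
    renewal inequality on [0, A] for its positive and negative parts, with a bound free of A. *)

(** * Times and marks of the points, and integrals against the point measure *)

Section marked_points.
Context (R : realType) (d dX : measure_display).
Context (Omega : measurableType d) (X : measurableType dX).
Context (T : nat -> Omega -> \bar R) (M : nat -> Omega -> option X).
Hypothesis TM : marked_point_process T M.

(** Real time and genuine mark of the k-th point. When [T k w = +oo] they take the default values 0
    and [point], so they are meaningful only under [T k w < +oo]. *)
Definition tau k w : measurableTypeR R := fine (T k w).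
Definition xi k w : X := odflt point (M k w).

Lemma mpp_EFin_tau k w : (T k w < +oo)%E -> T k w = (tau k w)%:E.
Proof.
by have := mpp_time_gt0 TM k w; rewrite /tau; case: (T k w).
Qed.

Lemma mpp_Some_xi k w : (T k w < +oo)%E -> M k w = Some (xi k w).
Proof.
move=> Tk; rewrite /xi; case E : (M k w) => [//|].
by move/(mpp_mark_none TM) : E Tk => ->.
Qed.

Lemma integral_point_mass k w (D : set (measurableTypeR R * X))
    (h : measurableTypeR R * X -> \bar R) :
  measurable D -> measurable_fun D h ->
  (\int[point_mass (T k w) (M k w)]_(z in D) h z =
   if (T k w < +oo)%E && ((tau k w, xi k w) \in D)
   then h (tau k w, xi k w) else 0)%E.
Proof.
move=> mD mh; case: ifPn => [/andP[Tk kD]|].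
  rewrite (mpp_Some_xi Tk) {1}(mpp_EFin_tau Tk) /= integral_dirac//.
  by rewrite diracE kD mul1e.
have [Tk|] := boolP (T k w < +oo)%E; last first.
  rewrite ltey negbK => /eqP ->.
  by case: (M k w) => /= [_|]; rewrite integral_measure_zero.
rewrite /= (mpp_Some_xi Tk) {1}(mpp_EFin_tau Tk) /= => kD.
by rewrite integral_dirac// diracE (negbTE kD) mul0e.
Qed.

Lemma integral_point_measure w (D : set (measurableTypeR R * X))
    (h : measurableTypeR R * X -> \bar R) :
  measurable D -> measurable_fun D h -> (forall z, D z -> (0 <= h z)%E) ->
  (\int[point_measure T M w]_(z in D) h z =
   \sum_(k <oo) if (T k w < +oo)%E && ((tau k w, xi k w) \in D)
                then h (tau k w, xi k w) else 0)%E.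
Proof.
move=> mD mh h0; rewrite /point_measure ge0_integral_measure_series//.
by apply: eq_eseriesr => k _; rewrite integral_point_mass.
Qed.

Lemma mpp_le_itv k w (s : R) :
  (T k w < +oo)%E && (tau k w \in `]0, s]%classic) = (T k w <= s%:E)%E.
Proof.
have := mpp_time_gt0 TM k w; rewrite /tau.
case: (T k w) => [r| |]//=; rewrite lte_fin ltry lee_fin => r0.
by rewrite mem_setE in_itv /= r0.
Qed.

Lemma mpp_lt_itv k w (s : R) :
  (T k w < +oo)%E && (tau k w \in `]0, s[%classic) = (T k w < s%:E)%E.
Proof.
have := mpp_time_gt0 TM k w; rewrite /tau.
case: (T k w) => [r| |]//=; rewrite lte_fin ltry lte_fin => r0.
by rewrite mem_setE in_itv /= r0.
Qed.

Lemma point_measure_itv_oc w (s : R) (A : set X) : measurable A ->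
  (point_measure T M w (`]0%R, s]%classic `*` A) =
   \sum_(k <oo) if (T k w <= s%:E)%E && (xi k w \in A) then 1 else 0)%E.
Proof.
move=> mA; have mD : measurable (`]0%R, s]%classic `*` A : set (measurableTypeR R
  * X)).
  by apply: measurableX => //; exact: measurable_itv.
rewrite -[LHS]mul1e -integral_cst// integral_point_measure//.
apply: eq_eseriesr => k _.
suff -> : (T k w < +oo)%E && ((tau k w, xi k w) \in `]0%R, s] `*` A) =
         (T k w <= s%:E)%E && (xi k w \in A) by [].
by rewrite -mpp_le_itv -andbA in_setX.
Qed.

Lemma mpp_le_mono w : {homo T ^~ w : i j / (i <= j)%N >-> (i <= j)%E}.
Proof. by apply/nondecreasing_seqP => n; exact: (mpp_time_le TM). Qed.

Lemma mpp_lt_mono w i j : (T i w < +oo)%E -> (i < j)%N -> (T i w < T j w)%E.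
Proof.
move=> Ti ij; apply: lt_le_trans (mpp_time_lt TM Ti) _.
exact: mpp_le_mono.
Qed.

(** Times increase strictly as long as they are finite; finiteness of [T i w] excludes the ties at
    +oo. *)
Lemma mpp_leE w i j : (T i w < +oo)%E -> (T i w <= T j w)%E = (i <= j)%N.
Proof.
move=> Ti; apply/idP/idP => [|/mpp_le_mono//].
apply: contraTT; rewrite -!ltNge -ltnNge => ji.
have [Tj|] := boolP (T j w < +oo)%E; first exact: mpp_lt_mono.
by rewrite ltey negbK => /eqP Tj; have := mpp_le_mono w (ltnW ji);
  rewrite Tj leye_eq => /eqP Ti'; rewrite Ti' in Ti.
Qed.

Lemma mpp_ltE w i j : (T j w < +oo)%E -> (T i w < T j w)%E = (i < j)%N.
Proof.
move=> Tj; rewrite ltNge mpp_leE// -ltnNge//.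
Qed.

Lemma measurable_tau k : measurable_fun setT (tau k).
Proof. by apply: measurableT_comp (mpp_time_measurable TM k). Qed.

Lemma measurable_xi k : measurable_fun setT (xi k).
Proof.
move=> _ B mB; rewrite setTI.
by apply: (mpp_mark_measurable TM k (B := [set o | B (odflt point o)])).
Qed.

End marked_points.

(** * Measurability with respect to the predictable sigma-field *)

Lemma sigma_algebra_ext (T : Type) (D : set T) (S : set (set T)) :
  sigma_algebra D S -> sigma_algebra setT [set C | S (C `&` D)].
Proof.
move=> [S0 SC SU]; split => /=.
- by rewrite set0I.
- by move=> A /SC; congr (S _); apply/seteqP; split => x /= [H1]; tauto.
- by move=> A SA; rewrite setI_bigcupl; exact: SU.
Qed.

Section predictable_sigma_field.
Context (R : realType) (d dX : measure_display).
Context (Omega : measurableType d) (X : measurableType dX).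
Variable Fil : R -> set (set Omega).
Hypothesis Fil_sigma : forall t, sigma_algebra setT (Fil t).
Hypothesis Fil_mono : forall s t : R, 0 <= s -> s <= t -> Fil s `<=` Fil t.

(* Sets whose trace on t >= 0 is predictable; extending the sigma-field to all
   of Omega x R makes it a measurableType, so that the library's closure lemmas
   for measurable functions apply to predictable processes. *)
Definition predictable_ext : set (set (Omega * R)) :=
  [set C | predictable Fil (C `&` (setT `*` `[0, +oo[%classic))].

Definition predictable_marked_ext : set (set (Omega * R * X)) :=
  [set C | predictable_marked Fil
             (C `&` ((setT `*` `[0, +oo[%classic) `*` setT))].

Definition pspace := g_sigma_algebraType predictable_ext.
Definition pmspace := g_sigma_algebraType predictable_marked_ext.
HB.instance Definition _ := Measurable.on pspace.
HB.instance Definition _ := Measurable.on pmspace.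

Lemma measurable_pspaceE (C : set pspace) : measurable C <-> predictable_ext C.
Proof.
suff -> : @measurable _ pspace = predictable_ext by [].
by apply: measurable_g_measurableTypeE; apply: sigma_algebra_ext;
  exact: smallest_sigma_algebra.
Qed.

Lemma measurable_pmspaceE (C : set pmspace) :
  measurable C <-> predictable_marked_ext C.
Proof.
suff -> : @measurable _ pmspace = predictable_marked_ext by [].
by apply: measurable_g_measurableTypeE; apply: sigma_algebra_ext;
  exact: smallest_sigma_algebra.
Qed.

Lemma Fil_setT t : Fil t setT.
Proof. by have [F0 FC _] := Fil_sigma t; rewrite -(setD0 setT); exact: FC. Qed.

(** The generators have bounded time intervals; the ray is a countable union of them. These sets are
    the building blocks of all predictability proofs below. *)
Lemma measurable_pspace_ray q (G : set Omega) : 0 <= q -> Fil q G ->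
  measurable (G `*` `]q, +oo[%classic : set pspace).
Proof.
move=> q0 FG.
rewrite (_ : _ `*` _ = \bigcup_k (G `*` `]q, q + k.+1%:R]%classic)); last first.
  apply/seteqP; split => -[w s] /=.
    rewrite in_itv/= andbT => -[Gw qs].
    exists (Num.truncn (s - q)) => //=; split => //; rewrite in_itv/= qs/=.
    by rewrite -lerBlDl ltW// truncnS_gt.
  by move=> [k _ /= []]; rewrite !in_itv/= andbT => Gw /andP[].
apply: bigcupT_measurable => k; apply/measurable_pspaceE.
rewrite /predictable_ext/= setIidl; last first.
  by move=> [w s] /= [_]; rewrite !in_itv/= andbT => /andP[qs _]; split => //;
    rewrite ltW// (le_lt_trans q0).
apply: sub_sigma_algebra; right; exists q, (q + k.+1%:R), G; split => //.
by rewrite ltrDl.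
Qed.

Lemma measurable_pspace_snd : measurable_fun setT (snd : pspace ->
  measurableTypeR R).
Proof.
apply: (measurability _ (RGenOInfty.measurableE R)) => _ [_ [a ->] <-].
rewrite setTI; have [a0|a0] := leP 0 a.
  have := measurable_pspace_ray a0 (@Fil_setT a); congr measurable.
  by apply/seteqP; split => -[w s] /= ; tauto.
apply/measurable_pspaceE.
have -> : predictable_ext (snd @^-1` `]a, +oo[) = predictable_ext setT.
  congr (predictable Fil _); apply/seteqP; split => -[w s] /= [_ [_ s0]];
    split => //.
  by move: s0; rewrite !in_itv/= !andbT; exact: lt_le_trans.
exact/measurable_pspaceE/measurableT.
Qed.

(** The section of a predictable set at time s0 is known at s0, so it may be switched on after s0.
    The sets C with this property form a sigma-field; for a generator G x ]s, t] with s < s0 <= t,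
    monotonicity puts G in [Fil s0]. *)
Lemma measurable_pspace_freeze (C : set pspace) s0 : 0 <= s0 -> measurable C ->
  measurable ([set z | C (z.1, s0) /\ s0 < z.2] : set pspace).
Proof.
move=> s00 /measurable_pspaceE mC.
suff : predictable Fil `<=` [set C | @measurable _ pspace
    [set z | C (z.1, s0) /\ s0 < z.2]].
  move=> /(_ _ mC) /=; congr measurable.
  apply/seteqP; split => -[w s] /= []; first by case.
  by split => //; split => //; split => //; rewrite in_itv/= s00.
apply: smallest_sub.
  split => /=.
  - suff -> : [set z : Omega * R | set0 (z.1, s0) /\ s0 < z.2] = set0 by [].
    by apply/seteqP; split => z //= [].
  - move=> A mA; have mT := measurable_pspace_ray s00 (@Fil_setT s0).
    have := measurableD mT mA; congr measurable.
    apply/seteqP; split => -[w s] /=; rewrite !in_itv/= !andbT.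
      by move=> [[_ ss0] nA]; split => //; split => // As; exact: nA.
    by move=> [[_ nA] ss0]; split => // -[].
  - move=> A mA; have := bigcupT_measurable _ mA; congr measurable.
    apply/seteqP; split => -[w s] /=.
      by move=> [k _ /= []] ? ?; split => //; exists k.
    by move=> [[k _ /= ?] ?]; exists k.
move=> _ [[G FG ->]|[s [t [G [s1 st FG ->]]]]] /=.
  have [->|s0n] := eqVneq s0 0.
    have := measurable_pspace_ray (lexx 0) FG; congr measurable.
    by apply/seteqP; split => -[w s] /=; rewrite in_itv/= andbT; tauto.
  rewrite [X in measurable X](_ : _ = set0)//.
  by apply/seteqP; split => -[w s] //= [[_ s0E]]; rewrite s0E eqxx in s0n.
have [sst|sst] := boolP (s < s0 <= t); last first.
  rewrite [X in measurable X](_ : _ = set0)//.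
  by apply/seteqP; split => -[w r] //= [[_]]; rewrite in_itv/= (negbTE sst).
have FsG : Fil s0 G by apply: (Fil_mono s1 _ FG); case/andP: sst => /ltW.
have := measurable_pspace_ray s00 FsG; congr measurable.
by apply/seteqP; split => -[w r] /=; rewrite !in_itv/= ?andbT ?sst => -[] // [].
Qed.

Lemma measurable_fun_pspace_freeze (G : pspace -> \bar R) s0 : 0 <= s0 ->
  measurable_fun setT G ->
  measurable_fun [set: pspace] (fun z => if s0 < z.2 then G (z.1, s0) else 0%E).
Proof.
move=> s00 mG _ B mB; rewrite setTI.
have mT : measurable ([set z | s0 < z.2] : set pspace).
  have := measurable_pspace_ray s00 (@Fil_setT s0); congr measurable.
  by apply/seteqP; split => -[w s] /=; rewrite in_itv/= andbT => // -[].
have := measurable_pspace_freeze s00 (mG measurableT _ mB); rewrite setTI => mGB.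
(* The function is 0 until s0, so the preimage of B contains that region exactly when B contains
   0. *)
have [B0|B0] := pselect (B 0%E).
  rewrite (_ : _ @^-1` B = [set z | (G @^-1` B) (z.1, s0) /\ s0 < z.2] `|`
    ~` [set z | s0 < z.2]); first by apply: measurableU => //; exact: measurableC.
  apply/seteqP; split => -[w s] /=; first by case: ifPn => [|/negP]; [left|right].
  by move=> [[Gs ->]//|/negP/negbTE ->].
rewrite (_ : _ @^-1` B = [set z | (G @^-1` B) (z.1, s0) /\ s0 < z.2])//.
by apply/seteqP; split => -[w s] /=; [case: ifPn|move=> [Gs ->]].
Qed.

Lemma measurable_pmspace_fst : measurable_fun setT (fst : pmspace -> pspace).
Proof.
move=> _ B /measurable_pspaceE mB; rewrite setTI.
apply/measurable_pmspaceE; apply: sub_sigma_algebra => /=.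
exists (B `&` (setT `*` `[0, +oo[%classic)), setT; split => //.
by apply/seteqP; split => -[[w s] x] /=; tauto.
Qed.

Lemma measurable_pmspace_snd : measurable_fun setT (snd : pmspace -> X).
Proof.
move=> _ B mB; rewrite setTI.
apply/measurable_pmspaceE; apply: sub_sigma_algebra => /=.
exists (setT `*` `[0, +oo[%classic), B; split => //.
  have /measurable_pspaceE := @measurableT _ pspace.
  by rewrite /predictable_ext/= setTI.
by apply/seteqP; split => -[[w s] x] /=; tauto.
Qed.

(* The last hypothesis says that L (w, s) is the supremum of G q w over the
   rationals q < s, so that L is left-continuous and adapted. *)
Lemma measurable_pspace_left (G : R -> Omega -> \bar R) (L : pspace -> \bar R) :
  (forall q c, 0 <= q -> Fil q [set w | (c < G q w)%E]) ->
  (forall w (s : R), 0 <= s -> (0 <= L (w, s))%E) ->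
  (forall w (s : R) (c : \bar R), (0 <= c)%E -> 0 <= s ->
    (c < L (w, s))%E <-> exists q : rat, 0 <= (ratr q : R) < s /\ (c < G (ratr q)
      w)%E) ->
  measurable_fun setT L.
Proof.
move=> FG L0 LG.
apply: (measurability _ (ErealGenOInfty.measurableE R)) => _ [_ [a ->] <-].
rewrite setTI; have [a0|a0] := leP 0 a.
  have : measurable (\bigcup_(q : rat) if 0 <= ratr q :> R then
      ([set w | (a%:E < G (ratr q) w)%E] `*` `](ratr q : R), +oo[%classic : set
        pspace)
      else set0).
    apply: bigcupT_measurable_rat => q; case: ifPn => // q0.
    by apply: measurable_pspace_ray => //; exact: FG.
  move=> /measurable_pspaceE H; apply/measurable_pspaceE; move: H;
    congr (predictable Fil _).
  apply/seteqP; split => -[w s] /= [H [_ s0]]; (split; last by split).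
    move: H => [q _]; case: ifPn => // q0 /= [aG]; rewrite !in_itv/= !andbT => qs.
    by apply/LG => //; [move: s0; rewrite in_itv/= andbT|exists q; rewrite q0].
  move: s0; rewrite in_itv/= andbT => s0.
  move: H; rewrite in_itv/= andbT => /LG -[//|//|q [/andP[q0 qs] aG]].
  by exists q => //; rewrite q0/=; split => //; rewrite in_itv/= qs.
apply/measurable_pspaceE.
have -> : predictable_ext (L @^-1` `]a%:E, +oo[) = predictable_ext setT.
  congr (predictable Fil _); apply/seteqP; split => -[w s] /= [_ [_ s0]];
    split => //.
  rewrite in_itv/= andbT (@lt_le_trans _ _ 0%E)// L0//.
  by move: s0; rewrite in_itv/= andbT.
exact/measurable_pspaceE/measurableT.
Qed.

End predictable_sigma_field.

(** * Predictable processes built from the natural filtration *)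

Section natural_filtration.
Context (R : realType) (d dX : measure_display).
Context (Omega : measurableType d) (X : measurableType dX).
Context (T : nat -> Omega -> \bar R) (M : nat -> Omega -> option X).
Hypothesis TM : marked_point_process T M.

Let N := point_measure T M.
Let Fil := natural_filtration N.
Local Notation xi := (xi M).

Lemma natural_filtration_sigma t : sigma_algebra setT (Fil t).
Proof. exact: smallest_sigma_algebra. Qed.

Lemma natural_filtration_mono s t : 0 <= s -> s <= t -> Fil s `<=` Fil t.
Proof.
move=> s0 st; apply: sub_smallest2r; first exact: smallest_sigma_algebra.
move=> C [u [A [B [/andP[u0 us] mA mB ->]]]].
by exists u, A, B; rewrite u0 (le_trans us).
Qed.

(** The process D^h at time q; [mark_sum_left] is its left limit D^h_{s-}, the version that is
    predictable. *)
Definition mark_sum (h : X -> \bar R) q w : \bar R :=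
  (\sum_(k <oo) if (T k w <= q%:E)%E then h (xi k w) else 0)%E.

Definition mark_sum_left (h : X -> \bar R) (z : Omega * R) : \bar R :=
  (\sum_(k <oo) if (T k z.1 < z.2%:E)%E then h (xi k z.1) else 0)%E.

(** The random measure N(]0, q] x .) on the marks, given as a series of point masses so that it is a
    measure by construction and the integral of h against it is [mark_sum h q w]. *)
Definition mark_measure q w : {measure set X -> \bar R} :=
  mseries (fun k => if (T k w <= q%:E)%E
                    then (\d_(xi k w) : {measure set X -> \bar R}) else mzero) 0.

Lemma mark_measureE q w A : measurable A ->
  mark_measure q w A = point_measure T M w (`]0%R, q]%classic `*` A).
Proof.
move=> mA; rewrite (point_measure_itv_oc TM)// /mark_measure/= /mseries.
apply: eq_eseriesr => k _; case: ifPn => //= _.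
by rewrite diracE; case: (_ \in A).
Qed.

Lemma integral_mark_measure q w h : measurable_fun setT h ->
  (forall x, (0 <= h x)%E) ->
  (\int[mark_measure q w]_x h x = mark_sum h q w)%E.
Proof.
move=> mh h0; rewrite ge0_integral_measure_series//.
apply: eq_eseriesr => k _; case: ifPn => _.
  by rewrite integral_dirac// diracT mul1e.
by rewrite integral_measure_zero.
Qed.

(** The filtration is generated by the values of N on sets ]0, s] x A only. Viewing [mark_measure q]
    as a kernel over the sigma-field generated up to q carries measurability from sets A to
    functions h. *)
Lemma mark_sum_measurable h q c : measurable_fun setT h ->
  (forall x, (0 <= h x)%E) -> 0 <= q -> Fil q [set w | (c < mark_sum h q w)%E].
Proof.
move=> mh h0 q0.
pose G := [set C | exists s (A : set X) (B : set (\bar R)),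
        [/\ 0 <= s <= q, measurable A, measurable B &
            C = (fun w => N w (`]0, s]%classic `*` A)) @^-1` B]].
have mk : forall U, measurable U ->
    measurable_fun [set: g_sigma_algebraType G] (mark_measure q ^~ U).
  move=> U mU _ B mB; rewrite setTI; apply: sub_sigma_algebra => /=.
  exists q, U, B; rewrite q0 lexx; split => //.
  by apply/funext => w; rewrite /preimage/= mark_measureE.
have := measurable_fun_integral_kernel mk h0 mh.
move=> /(_ measurableT _ (emeasurable_itv `]c, +oo[)).
rewrite setTI; congr (Fil q _); apply/seteqP; split => w /=;
  by rewrite in_itv/= andbT integral_mark_measure.
Qed.

(** If the series exceeds c, so does a finite partial sum; the finitely many times in it that lie
    below s are all at most some q < s, and a rational fits between q and s. This is
    left-continuity, and it needs no local finiteness of the points. *)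
Lemma mark_sum_leftP (h : X -> \bar R) w (s : R) (c : \bar R) :
  (forall x, 0 <= h x)%E -> (0 <= c)%E -> 0 <= s ->
  (c < mark_sum_left h (w, s))%E <->
  exists q : rat, 0 <= (ratr q : R) < s /\ (c < mark_sum h (ratr q) w)%E.
Proof.
move=> h0 c0 s0; split; last first.
  move=> [q [/andP[q0 qs] cq]]; apply: (lt_le_trans cq).
  apply: lee_nneseries => [k _ _|k _ /=]; first by case: ifP.
  case: ifPn => [Tq|_]; last by case: ifP.
  by rewrite (le_lt_trans Tq) ?lte_fin.
rewrite /mark_sum_left => cL.
have [n cn] : exists n, (c < \sum_(0 <= k < n)
    if (T k w < s%:E)%E then h (xi k w) else 0)%E.
  apply: contrapT => /forallNP H; move: cL; apply/negP; rewrite -leNgt.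
  apply: lime_le.
    by apply: is_cvg_nneseries => k _ _; case: ifP.
  by apply: nearW => k; rewrite leNgt; apply/negP/H.
have [q [q0 qs qT]] : exists q : R, [/\ 0 <= q, q < s &
    forall k, (k < n)%N -> (T k w < s%:E)%E -> (T k w <= q%:E)%E].
  have sp : 0 < s.
    rewrite lt_neqAle s0 andbT; apply/eqP => s00; move: cn.
    rewrite big1 ?ltNge ?c0// => k _.
    by rewrite -s00 ltNge (ltW (mpp_time_gt0 TM _ _)).
  clear cn; elim: n => [|n [q [q0 qs qT]]].
    by exists 0.
  have [Tn|Tn] := boolP (T n w < s%:E)%E; last first.
    exists q; split => // k; rewrite ltnS leq_eqVlt => /orP[/eqP ->|/qT//].
    by rewrite (negbTE Tn).
  have Tfin : (T n w < +oo)%E by rewrite (lt_le_trans Tn)// leey.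
  have TE := mpp_EFin_tau TM Tfin.
  exists (Num.max q (tau T n w)); split.
  - by rewrite le_max q0.
  - by rewrite gt_max qs -lte_fin -TE.
  - move=> k; rewrite ltnS leq_eqVlt => /orP[/eqP ->|kn /(qT _ kn)] .
      by rewrite {2}TE => _; rewrite lee_fin le_max lexx orbT.
    by move/le_trans; apply; rewrite lee_fin le_max lexx.
have [p] := rat_in_itvoo qs; rewrite in_itv /= => /andP[qp ps].
exists p; rewrite ps (le_trans q0 (ltW qp)); split => //.
apply: (lt_le_trans cn); apply: (@le_trans _ _ (\sum_(0 <= k < n)
    if (T k w <= (ratr p)%:E)%E then h (xi k w) else 0)%E).
  rewrite big_nat_cond [leRHS]big_nat_cond; apply: lee_sum => k /andP[/= kn _].
  case: ifPn => [Ts|_]; last by case: ifP.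
  by rewrite (le_trans (qT _ kn Ts))// lee_fin ltW.
by apply: nneseries_lim_ge => k _ _; case: ifP.
Qed.

Lemma measurable_mark_sum_left h : measurable_fun setT h ->
  (forall x, (0 <= h x)%E) ->
  measurable_fun [set: pspace Fil] (mark_sum_left h).
Proof.
move=> mh h0.
apply: (@measurable_pspace_left _ _ _ Fil (mark_sum h)).
- by move=> q c q0; exact: mark_sum_measurable.
- by move=> w s s0; apply: nneseries_ge0 => k _ _; case: ifP.
- by move=> w s c c0 s0; exact: mark_sum_leftP.
Qed.

(** Indices start at 0, so [T n] is the time of the point number n + 1: it has occurred by q exactly
    when more than n points have. This expresses [T n] through N, hence makes it a stopping time. *)
Lemma mark_sum1_count n q w :
  (n%:R%:E < mark_sum (cst 1%E) q w)%E = (T n w <= q%:E)%E.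
Proof.
apply/idP/idP => [|Tn].
  apply: contraTT; rewrite -ltNge -leNgt => qT.
  apply: lime_le.
    by apply: is_cvg_nneseries => k _ _; case: ifP.
  apply: nearW => k /=.
  apply: (@le_trans _ _ (\sum_(0 <= i < k) if (i < n)%N then 1 else 0)%E).
    apply: lee_sum => i _; case: ifPn => Ti; last by case: ifP.
    rewrite ifT// ltnNge; apply/negP => /(mpp_le_mono TM w) /(lt_le_trans qT).
    by rewrite ltNge Ti.
  apply: (@le_trans _ _ (minn k n)%:R%:E%E);
    last by rewrite lee_fin ler_nat geq_minr.
  rewrite le_eqVlt; apply/orP; left; apply/eqP.
  elim: k => [|k IH]; first by rewrite big_geq// min0n.
  rewrite big_nat_recr//= IH; case: ltnP => kn.
    by rewrite (minn_idPl kn) -EFinD natr1.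
  by rewrite adde0 (minn_idPr (leqW kn)).
apply: (@lt_le_trans _ _ n.+1%:R%:E%E); first by rewrite lte_fin ltr_nat.
apply: (@le_trans _ _ (\sum_(0 <= k < n.+1)
    if (T k w <= q%:E)%E then 1 else 0)%E); last first.
  by apply: nneseries_lim_ge => k _ _; case: ifP.
rewrite big_nat_cond (eq_bigr (fun=> 1%E)); last first.
  by move=> k /andP[/= kn _]; rewrite ifT// (le_trans _ Tn)// (mpp_le_mono TM).
by rewrite -big_nat_cond sumEFin sumr_const_nat subn0.
Qed.

(** The complement of this stochastic interval, where T n < s, is the union over rationals q >= 0 of
    the sets where T n <= q < s, and T n <= q is an event of [Fil q] by counting points. *)
Lemma measurable_pspace_stop n :
  measurable ([set z | (z.2%:E <= T n z.1)%E] : set (pspace Fil)).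
Proof.
rewrite (_ : [set z | _] = ~` (\bigcup_(q : rat) if 0 <= ratr q :> R then
    ([set w | (T n w <= (ratr q)%:E)%E] `*` `](ratr q : R), +oo[%classic)
    else set0)); last first.
  apply/seteqP; split => -[w s] /= H.
    move=> [q _]; case: ifPn => // q0 /= [Tq]; rewrite in_itv/= andbT.
    by rewrite ltNge -lee_fin (le_trans H).
  rewrite leNgt; apply/negP => Ts; apply: H.
  have Tfin : (T n w < +oo)%E by rewrite (lt_le_trans Ts)// leey.
  move: Ts; rewrite (mpp_EFin_tau TM Tfin) lte_fin => /rat_in_itvoo[q];
    rewrite in_itv /= => /andP[tq qs].
  have q0 : 0 <= ratr q :> R.
    by rewrite ltW// (lt_trans _ tq)// -lte_fin -(mpp_EFin_tau TM Tfin)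
      (mpp_time_gt0 TM).
  exists q => //; rewrite q0 /= in_itv/= qs; split => //.
  by rewrite (mpp_EFin_tau TM Tfin) lee_fin ltW.
apply: measurableC; apply: bigcupT_measurable_rat => q; case: ifPn => // q0.
apply: (measurable_pspace_ray q0).
rewrite (_ : [set w | _] = [set w | n%:R%:E < mark_sum (cst 1%E) (ratr q) w]%E).
  by apply: mark_sum_measurable.
by apply/seteqP; split => w /=; rewrite mark_sum1_count.
Qed.

End natural_filtration.

(** * Auxiliary facts on series, Lebesgue integrals and Markov's inequality *)

Lemma nneseries_finite (R : realType) (u : nat -> \bar R) n :
  (forall k, 0 <= u k)%E -> (forall k, (n <= k)%N -> u k = 0%E) ->
  (\sum_(k <oo) u k = \sum_(k < n) u k)%E.
Proof.
move=> u0 un; rewrite (nneseries_split 0 n)// add0n [X in (_ + X)%E]eseries0.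
  by rewrite adde0 big_mkord.
by move=> k nk _; exact: un.
Qed.

Section lebesgue_reflection.
Context (R : realType).
Local Notation mu := (@lebesgue_measure R).

Lemma measurable_subl (u : R) :
  measurable_fun [set: measurableTypeR R] (fun s : measurableTypeR R => u - s :
    measurableTypeR R).
Proof. by apply: measurable_funB. Qed.

Lemma lebesgue_measure_subl (u : R) (A : set R) : measurable A ->
  pushforward mu ((fun s => u - s) : measurableTypeR R -> measurableTypeR R) A =
    mu A.
Proof.
move=> mA; apply/esym/lebesgue_measure_unique => //=.
  by exact: measurable_subl.
move=> mf _ [[a b] _ <-]; rewrite /pushforward.
rewrite (_ : _ @^-1` _ = `[u - b, u - a[%classic); last first.
  by apply/seteqP; split => s /=; rewrite !in_itv/= => /andP[? ?]; apply/andP;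
    split; lra.
rewrite !lebesgue_measure_itv/= !lte_fin ltrD2l ltrN2.
by case: ifP => // _; rewrite -!EFinB; congr EFin; ring.
Qed.

Lemma ge0_integral_subl (u : R) (g : measurableTypeR R -> \bar R) :
  measurable_fun setT g -> (forall s, 0 <= g s)%E ->
  (\int[mu]_s g (u - s)%R = \int[mu]_s g s)%E.
Proof.
move=> mg g0.
have := @ge0_integral_pushforward _ _ _ _ _ _ (measurable_subl u) mu setT g.
rewrite preimage_setT /= => <- //.
apply: eq_measure_integral => /=; first exact: measurable_subl.
by move=> _ A mA _; exact: lebesgue_measure_subl.
Qed.

Lemma ge0_integral_subr (u : R) (g : measurableTypeR R -> \bar R) :
  measurable_fun setT g -> (forall s, 0 <= g s)%E ->
  (\int[mu]_s g (s - u)%R = \int[mu]_s g s)%E.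
Proof.
move=> mg g0; rewrite -(ge0_integral_subl 0 mg g0).
have mg' : measurable_fun setT (fun s : measurableTypeR R => g (0 - s)).
  by apply: (measurableT_comp mg); exact: measurable_subl.
rewrite -(ge0_integral_subl u mg')//.
by apply: eq_integral => s _; rewrite sub0r opprB.
Qed.

End lebesgue_reflection.

Lemma integral_lebesgue_diag (R : realType) (a : R) (k : R -> \bar R) :
  (\int[@lebesgue_measure R]_u (if u == a then k u else 0) = 0)%E.
Proof.
rewrite -[RHS](integral_set1 k a) [RHS]integral_mkcond; apply: eq_integral => u _.
rewrite /patch; case: eqP => [->|ua]; first by rewrite mem_set.
by rewrite memNset.
Qed.

(** The plane splits along the diagonal into two triangles with equal integrals by symmetry and
    Tonelli. It produces the factor 1/2 in E [D Lambda]. *)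
Lemma integral_sqr_triangle (R : realType) (g : measurableTypeR R -> \bar R) :
  measurable_fun setT g -> (forall s, 0 <= g s)%E ->
  ((\int[@lebesgue_measure R]_s g s) * (\int[@lebesgue_measure R]_s g s) =
   2%:E * \int[@lebesgue_measure R]_s \int[@lebesgue_measure R]_u
     (if (s < u)%R then g s * g u else 0))%E.
Proof.
move=> mg g0; set mu := @lebesgue_measure R.
pose K (z : measurableTypeR R * measurableTypeR R) :=
  (if (z.1 < z.2)%R then g z.1 * g z.2 else 0)%E.
have g1 : measurable_fun [set: measurableTypeR R * measurableTypeR R] (fun z => g
  z.1).
  by apply: (measurableT_comp mg); exact: measurable_fst.
have g2 : measurable_fun [set: measurableTypeR R * measurableTypeR R] (fun z => g
  z.2).
  by apply: (measurableT_comp mg); exact: measurable_snd.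
have mK : measurable_fun setT K.
  apply: measurable_fun_ifT => //; last exact: emeasurable_funM.
  by apply: measurable_fun_ltr; [exact: measurable_fst|exact: measurable_snd].
have K0 z : (0 <= K z)%E by rewrite /K; case: ifP => // _; rewrite mule_ge0.
have mKs : measurable_fun [set: measurableTypeR R * measurableTypeR R] (fun z =>
  K (z.2, z.1)).
  apply: (measurableT_comp mK); apply: measurable_fun_pair;
    [exact: measurable_snd|exact: measurable_fst].
have S (s : measurableTypeR R) : (g s * \int[mu]_u g u =
    \int[mu]_u K (s, u) + \int[mu]_u K (u, s))%E.
  have mK1 := measurable_fun_pair2 s mK.
  have mK2 := measurable_fun_pair1 s mK.
  rewrite -ge0_integralZl// -ge0_integralD//.
  have mgs : measurable_fun [set: measurableTypeR R] (fun u => if u == s then g s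
    * g u else 0)%E.
    apply: measurable_fun_ifT => //; last exact: measurable_funeM.
    by apply: measurable_fun_eqr.
  (* A null term supported at u = s is added, so that the integrands agree at every u and not just
     almost everywhere. *)
  rewrite -[RHS]adde0 -(integral_lebesgue_diag s (fun u => g s * g u)%E)
    -ge0_integralD//.
  - apply: eq_integral => u _; rewrite /K/=.
    by case: ltgtP => us; rewrite ?adde0 ?add0e// muleC.
  - by move=> u _; rewrite adde_ge0.
  - exact: emeasurable_funD.
  - by move=> u _; case: ifP => // _; rewrite mule_ge0.
have I0 : (0 <= \int[mu]_u g u)%E by exact: integral_ge0.
rewrite -ge0_integralZr//; under eq_integral do rewrite S.
rewrite ge0_integralD//.
- rewrite -(fubini_tonelli (m1 := mu) (m2 := mu) K)//.
  by rewrite -mule2n mule_natl.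
- by move=> s _; exact: integral_ge0.
- exact: (measurable_fun_fubini_tonelli_F (m2 := mu) K).
- by move=> s _; exact: integral_ge0.
- exact: (measurable_fun_fubini_tonelli_G (m1 := mu) K).
Qed.

Lemma markov_ge0 (R : realType) (d : measure_display) (T : measurableType d)
    (mu : {measure set T -> \bar R}) (g : T -> \bar R) (a : R) :
  measurable_fun setT g -> (forall w, 0 <= g w)%E -> 0 <= a ->
  (a%:E * mu [set w | a%:E <= g w] <= \int[mu]_w g w)%E.
Proof.
move=> mg g0 a0.
have mA : measurable [set w | a%:E <= g w]%E.
  by rewrite -[X in measurable X]setTI; apply: measurable_lee.
rewrite -integral_cst//;
  apply: (@le_trans _ _ (\int[mu]_(w in [set w | a%:E <= g w]) g w)%E).
  by apply: ge0_le_integral => //; exact: measurable_funTS.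
by apply: ge0_subset_integral.
Qed.

Lemma integral_probability_cst (R : realType) (d : measure_display)
    (T : measurableType d) (P : probability T R) (c : \bar R) :
  (\int[P]_w c = c)%E.
Proof.
rewrite integral_cst//; transitivity (c * 1)%E; last by rewrite mule1.
by congr (_ * _)%E; exact: probability_setT.
Qed.

(** * Renewal inequality and the L^1 norm of the resolvent *)

Section resolvent.
Context (R : realType).
Local Notation mu := (@lebesgue_measure R).
Variables (F : R -> R) (C rho : R).
Hypothesis F_ge0 : forall s, 0 <= F s.
Hypothesis F_lt0 : forall s, s < 0 -> F s = 0.
Hypothesis F_le : forall s, F s <= C.
Hypothesis mF : measurable_fun [set: measurableTypeR R] (F : measurableTypeR R ->
  R).
Hypothesis F_int : (\int[mu]_s (F s)%:E = rho%:E)%E.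
Hypothesis rho1 : rho < 1.

Let rho_ge0 : 0 <= rho.
Proof. by rewrite -lee_fin -F_int integral_ge0// => s _; rewrite lee_fin. Qed.

(** Convolution for non-negative functions, over the whole line and with values in [\bar R]. As F
    vanishes at negative times, only s <= t contributes. *)
Definition conv_ge0 (g : R -> R) t : \bar R := (\int[mu]_s (F (t - s)%R * g
  s)%:E)%E.

Lemma measurable_conv_kernel (g : R -> R) :
  measurable_fun [set: measurableTypeR R] (g : measurableTypeR R -> R) ->
  measurable_fun [set: measurableTypeR R * measurableTypeR R]
    (fun z => (F (z.1 - z.2)%R * g z.2)%:E).
Proof.
move=> mg; apply/measurable_EFinP; apply: measurable_funM.
  apply: (measurableT_comp mF (g := fun z : measurableTypeR R * measurableTypeR R =>
    z.1 - z.2 : measurableTypeR R)).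
  by apply: measurable_funB; [exact: measurable_fst|exact: measurable_snd].
by apply: (measurableT_comp mg); exact: measurable_snd.
Qed.

Lemma conv_ge0_ge0 g t : (forall s, 0 <= g s) -> (0 <= conv_ge0 g t)%E.
Proof. by move=> g0; apply: integral_ge0 => s _; rewrite lee_fin mulr_ge0. Qed.

Lemma measurable_conv_ge0 (g : R -> R) :
  measurable_fun [set: measurableTypeR R] (g : measurableTypeR R -> R) ->
  (forall s, 0 <= g s) ->
  measurable_fun [set: measurableTypeR R] (conv_ge0 g : measurableTypeR R -> \bar
    R).
Proof.
move=> mg g0;
  apply: (measurable_fun_fubini_tonelli_F (m2 := mu) _ (measurable_conv_kernel mg)).
by move=> z; rewrite lee_fin mulr_ge0.
Qed.

Lemma integral_conv_ge0 (g : R -> R) :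
  measurable_fun [set: measurableTypeR R] (g : measurableTypeR R -> R) ->
  (forall s, 0 <= g s) ->
  (\int[mu]_t conv_ge0 g t = rho%:E * \int[mu]_s (g s)%:E)%E.
Proof.
move=> mg g0; have mk := measurable_conv_kernel mg.
rewrite /conv_ge0 (fubini_tonelli (m1 := mu) (m2 := mu) _ mk)/=; last first.
  by move=> z; rewrite lee_fin mulr_ge0.
have mFE : measurable_fun [set: measurableTypeR R] (fun s => (F s)%:E).
  exact/measurable_EFinP.
have F0E s : (0 <= (F s)%:E)%E by rewrite lee_fin.
rewrite -ge0_integralZl ?lee_fin//; last 2 first.
- exact/measurable_EFinP.
- by move=> s _; rewrite lee_fin.
apply: eq_integral => s _.
under eq_integral do rewrite EFinM.
rewrite ge0_integralZr ?lee_fin//.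
  by rewrite (ge0_integral_subr s mFE)// F_int.
apply/measurable_EFinP; apply: (measurableT_comp mF
  (g := fun t : measurableTypeR R => t - s : measurableTypeR R)).
exact: measurable_funB.
Qed.

(** For t <= A the convolution sees g only on s <= A. Integrating the inequality over t <= A gives I
    <= rho I + b rho for the truncated integral I, and I is finite, so it can be solved for I. The
    bound does not depend on A. *)
Lemma renewal_inequality (g : R -> R) (b A : R) :
  measurable_fun [set: measurableTypeR R] (g : measurableTypeR R -> R) ->
  (forall s, 0 <= g s) -> (forall s, s < 0 -> g s = 0) -> 0 <= b ->
  (\int[mu]_s (if s <= A then g s else 0)%:E < +oo)%E ->
  (forall t, 0 <= t -> ((g t)%:E <= conv_ge0 g t + (b * F t)%:E)%E) ->
  (\int[mu]_s (if s <= A then g s else 0)%:E <= (b * rho / (1 - rho))%:E)%E.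
Proof.
move=> mg g0 gn b0 gfin gle.
pose gA s := if s <= A then g s else 0.
have mgA : measurable_fun [set: measurableTypeR R] (gA : measurableTypeR R -> R).
  by apply: measurable_fun_ifT => //; exact: measurable_fun_ler.
have gA0 s : 0 <= gA s by rewrite /gA; case: ifP.
have H : (\int[mu]_s (gA s)%:E <= rho%:E * \int[mu]_s (gA s)%:E + (b * rho)%:E)%E.
  rewrite -integral_conv_ge0// EFinM -F_int -ge0_integralZl//; last 2 first.
  - exact/measurable_EFinP.
  - by move=> s _; rewrite lee_fin.
  rewrite -ge0_integralD//; last 4 first.
  - by move=> s _; exact: conv_ge0_ge0.
  - exact: measurable_conv_ge0.
  - by move=> s _; rewrite -EFinM lee_fin mulr_ge0.
  - by apply: measurable_funeM; exact/measurable_EFinP.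
  apply: ge0_le_integral => //.
  - by move=> s _; rewrite lee_fin.
  - exact/measurable_EFinP.
  - apply: emeasurable_funD; first exact: measurable_conv_ge0.
    by apply: measurable_funeM; exact/measurable_EFinP.
  move=> t _; rewrite /gA.
  have c0 : (0 <= conv_ge0 gA t + b%:E * (F t)%:E)%E.
    by rewrite adde_ge0 ?conv_ge0_ge0// -EFinM lee_fin mulr_ge0.
  case: ifPn => // tA; have [t0|t0] := leP 0 t; last by rewrite gn.
  apply: (le_trans (gle t t0)); rewrite -EFinM leeD2r//.
  rewrite le_eqVlt; apply/orP; left; apply/eqP; apply: eq_integral => s _.
  congr EFin; have [st|st] := leP s t; first by rewrite /gA (le_trans st tA).
  by rewrite F_lt0 ?mul0r// subr_lt0.
have Ifin : (\int[mu]_s (gA s)%:E)%E \is a fin_num.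
  by rewrite ge0_fin_numE// integral_ge0// => s _; rewrite lee_fin.
move: H; rewrite -/(gA _) -(fineK Ifin) -EFinM -EFinD !lee_fin => H.
by rewrite ler_pdivlMr ?subr_gt0//; lra.
Qed.

Variable r : R -> R.
Hypothesis r_int : forall t, 0 <= t -> mu.-integrable `[0, t] (EFin \o r).
Hypothesis rE : forall t, 0 <= t -> r t = convol F r t - F t.

(** Positive and negative parts of r on the half-line, extended by 0, so that the convolutions below
    have non-negative integrands. *)
Let rp s := if 0 <= s then Num.max (r s) 0 else 0.
Let rn s := if 0 <= s then Num.max (- r s) 0 else 0.

Let rp0 s : 0 <= rp s. Proof. by rewrite /rp; case: ifP => // _;
  rewrite le_max lexx orbT. Qed.
Let rn0 s : 0 <= rn s. Proof. by rewrite /rn; case: ifP => // _;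
  rewrite le_max lexx orbT. Qed.

Lemma measurable_resolvent :
  measurable_fun (`[0, +oo[%classic : set (measurableTypeR R)) (r :
    measurableTypeR R -> R).
Proof.
rewrite (_ : `[0, +oo[%classic = \bigcup_k `[0, k%:R : R]%classic); last first.
  apply/seteqP; split => s /=.
    rewrite in_itv/= andbT => s0; exists (Num.truncn s).+1 => //=.
    by rewrite in_itv/= s0 ltW// truncnS_gt.
  by move=> [k _ /=]; rewrite !in_itv/= andbT => /andP[].
apply/measurable_fun_bigcup => k; first exact: measurable_itv.
by have /integrableP[/measurable_EFinP] := r_int (ler0n R k).
Qed.

Let mr (u : R -> R) : measurable_fun [set: R] u ->
  measurable_fun [set: measurableTypeR R] (fun s : measurableTypeR R => if 0 <= s
    then u (r s) else 0).
Proof.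
move=> mu'.
have mI : measurable (`[0, +oo[%classic : set (measurableTypeR R)) by exact:
  measurable_itv.
have := (measurable_restrictT _ mI).1 (measurableT_comp mu' measurable_resolvent).
congr measurable_fun; apply/funext => s.
by rewrite /patch mem_setE in_itv/= andbT.
Qed.

Let mrp : measurable_fun [set: measurableTypeR R] (rp : measurableTypeR R -> R).
Proof. by apply: (mr (u := fun x => Num.max x 0)); exact: measurable_maxr. Qed.

Let mrn : measurable_fun [set: measurableTypeR R] (rn : measurableTypeR R -> R).
Proof.
by apply: (mr (u := fun x => Num.max (- x) 0)); apply: measurable_maxr => //;
  exact: measurable_funN.
Qed.

Lemma resolvent_part_fin (g : R -> R) A : (forall s, 0 <= s -> 0 <= g s <= `|r
  s|) ->
  (forall s, s < 0 -> g s = 0) ->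
  measurable_fun [set: measurableTypeR R] (g : measurableTypeR R -> R) ->
  (\int[mu]_s (if s <= A then g s else 0)%:E < +oo)%E.
Proof.
move=> gr gn mg.
have [A0|A0] := leP 0 A; last first.
  rewrite integral0_eq ?ltry// => s _; case: ifP => // sA.
  by rewrite gn// (le_lt_trans sA).
have /integrableP[mrA] := r_int A0; apply: le_lt_trans.
rewrite [leRHS]integral_mkcond; apply: ge0_le_integral => //.
- move=> s _; rewrite lee_fin; case: ifP => // _.
  by have [/gr/andP[]//|/gn ->] := leP 0 s.
- apply/measurable_EFinP; apply: measurable_fun_ifT => //;
  exact: measurable_fun_ler.
- apply/(measurable_restrictT _ _).1; first exact: measurable_itv.
  exact: measurableT_comp.
- move=> s _; rewrite /patch mem_setE in_itv/=.
  have [s0|s0] := leP 0 s; last by rewrite gn// if_same.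
  by case: ifP => // _; rewrite lee_fin; have /andP[] := gr _ s0.
Qed.

Let rp_le s : 0 <= s -> 0 <= rp s <= `|r s|.
Proof. by move=> s0; rewrite rp0/= /rp s0 ge_max normr_ge0 ler_norm. Qed.

Let rn_le s : 0 <= s -> 0 <= rn s <= `|r s|.
Proof. by move=> s0; rewrite rn0/= /rn s0 ge_max normr_ge0 -normrN ler_norm. Qed.

Let rp_lt0 s : s < 0 -> rp s = 0.
Proof. by rewrite /rp ltNge => /negbTE ->. Qed.

Let rn_lt0 s : s < 0 -> rn s = 0.
Proof. by rewrite /rn ltNge => /negbTE ->. Qed.

(** Boundedness of F makes the convolution with a locally integrable g finite at every t, not just
    almost every t, so the equation for r can be split pointwise. *)
Lemma conv_ge0_le (g : R -> R) t :
  measurable_fun [set: measurableTypeR R] (g : measurableTypeR R -> R) ->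
  (forall s, 0 <= g s) ->
  (conv_ge0 g t <= C%:E * \int[mu]_s (if s <= t then g s else 0)%:E)%E.
Proof.
move=> mg g0; have C0 : 0 <= C by rewrite (le_trans (F_ge0 0)).
have mgt : measurable_fun [set: measurableTypeR R]
    (fun s : measurableTypeR R => (if s <= t then g s else 0)%:E).
  by apply/measurable_EFinP; apply: measurable_fun_ifT => //;
    exact: measurable_fun_ler.
rewrite -ge0_integralZl//; last by move=> s _; case: ifP; rewrite lee_fin.
apply: ge0_le_integral => //.
- by move=> s _; rewrite lee_fin mulr_ge0.
- exact: (measurable_fun_pair2 t (measurable_conv_kernel mg)).
- exact: measurable_funeM.
- move=> s _; rewrite -EFinM lee_fin; have [st|st] := leP s t;
  first by rewrite ler_wpM2r.
  by rewrite F_lt0 ?mul0r ?mulr0// subr_lt0.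
Qed.

Let conv_rp_fin t : conv_ge0 rp t \is a fin_num.
Proof.
rewrite ge0_fin_numE ?conv_ge0_ge0//; apply: (le_lt_trans (conv_ge0_le _ mrp rp0)).
have := resolvent_part_fin t rp_le rp_lt0 mrp.
set I := (\int[mu]_s _)%E => Ify.
have If : I \is a fin_num by rewrite ge0_fin_numE// integral_ge0// => s _;
  case: ifP; rewrite lee_fin.
by rewrite -(fineK If) -EFinM ltry.
Qed.

Let conv_rn_fin t : conv_ge0 rn t \is a fin_num.
Proof.
rewrite ge0_fin_numE ?conv_ge0_ge0//; apply: (le_lt_trans (conv_ge0_le _ mrn rn0)).
have := resolvent_part_fin t rn_le rn_lt0 mrn.
set I := (\int[mu]_s _)%E => Ify.
have If : I \is a fin_num by rewrite ge0_fin_numE// integral_ge0// => s _;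
  case: ifP; rewrite lee_fin.
by rewrite -(fineK If) -EFinM ltry.
Qed.

(** As F >= 0, the positive and negative parts of F(t - s) r(s) on [0, t] are F(t - s) [rp] s and
    F(t - s) [rn] s. *)
Lemma resolvent_parts t : 0 <= t ->
  r t = fine (conv_ge0 rp t) - fine (conv_ge0 rn t) - F t.
Proof.
move=> t0; rewrite rE//; congr (_ - _); rewrite /convol /Rintegral.
rewrite integral_mkcond integralE.
pose k : R -> \bar R := (fun s => (F (t - s) * r s)%:E) \_ `[0, t]%classic.
have fp : (fun s => (F (t - s) * rp s)%:E) = (k^\+)%E.
  apply/funext => s; rewrite funeposE /k /patch mem_setE in_itv/= /rp.
  have [s0|s0] := leP 0 s; last by rewrite mulr0 maxxx.
  have [st|st] := leP s t; last by rewrite F_lt0 ?subr_lt0// mul0r maxxx.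
  by rewrite -EFin_max maxr_pMr// mulr0.
have fn : (fun s => (F (t - s) * rn s)%:E) = (k^\-)%E.
  apply/funext => s; rewrite funenegE /k /patch mem_setE in_itv/= /rn.
  have [s0|s0] := leP 0 s; last by rewrite mulr0 oppe0 maxxx.
  have [st|st] := leP s t; last by rewrite F_lt0 ?subr_lt0// mul0r oppe0 maxxx.
  by rewrite -EFinN -EFin_max -mulrN maxr_pMr// mulr0.
rewrite -/k -fp -fn -/(conv_ge0 rp t) -/(conv_ge0 rn t) fineB ?conv_rp_fin
  ?conv_rn_fin//.
Qed.

(** Dropping negative terms gives [rp] <= F * [rp], so the renewal inequality with b = 0 makes the
    integral of [rp] over [0, t] vanish; the pointwise bound on the convolution then yields [rp] t =
    0 at each t. *)
Lemma resolvent_le0 t : 0 <= t -> r t <= 0.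
Proof.
move=> t0.
have rp_conv s : 0 <= s -> ((rp s)%:E <= conv_ge0 rp s + (0 * F s)%:E)%E.
  move=> s0; rewrite mul0r adde0 -(fineK (conv_rp_fin s)) lee_fin /rp s0.
  rewrite ge_max fine_ge0 ?conv_ge0_ge0// andbT (resolvent_parts s0).
  have : 0 <= fine (conv_ge0 rn s) by rewrite fine_ge0// conv_ge0_ge0.
  have := F_ge0 s; lra.
have := renewal_inequality mrp rp0 rp_lt0 (lexx 0)
  (resolvent_part_fin t rp_le rp_lt0 mrp) rp_conv.
rewrite !mul0r => It.
have I0 : (\int[mu]_s (if s <= t then rp s else 0)%:E = 0)%E.
  apply/eqP; rewrite eq_le It integral_ge0// => s _; case: ifP; rewrite lee_fin//.
have := le_trans (rp_conv t t0) (leeD2r _ (conv_ge0_le t mrp rp0)).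
rewrite I0 mule0 mul0r adde0 lee_fin /rp t0 ge_max => /andP[].
by [].
Qed.

(** With r <= 0 the equation reads [rn] = F * [rn] + F. The renewal inequality with b = 1 bounds the
    integral over each s <= A, monotone convergence makes the full integral I finite, and then I =
    rho I + rho can be solved. *)
Lemma L1_norm_resolvent (Res : R -> R) : (forall t, 0 <= t -> Res t = - r t) ->
  L1_norm Res = (rho / (1 - rho))%:E.
Proof.
move=> ResE.
have rpE : rp = cst 0.
  apply/funext => s; rewrite /rp /=; case: ifP => // s0.
  by apply/max_idPr; exact: resolvent_le0.
have rn_conv s : 0 <= s -> ((rn s)%:E = conv_ge0 rn s + (F s)%:E)%E.
  move=> s0; rewrite -(fineK (conv_rn_fin s)) -EFinD; congr EFin.
  have r0 : 0 <= - r s by rewrite oppr_ge0 resolvent_le0.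
  rewrite /rn s0 (max_idPl r0).
  rewrite (resolvent_parts s0) rpE.
  have -> : conv_ge0 (cst 0) s = 0%E by apply: integral0_eq => u _; rewrite mulr0.
  by rewrite /=; ring.
have rn_convT s : ((rn s)%:E = conv_ge0 rn s + (F s)%:E)%E.
  have [/rn_conv//|s0] := leP 0 s.
  rewrite rn_lt0// F_lt0// adde0; apply/esym/integral0_eq => u _.
  have [us|us] := ltP u 0; first by rewrite rn_lt0// mulr0.
  by rewrite F_lt0 ?mul0r// subr_lt0 (lt_le_trans s0).
have L1E : (L1_norm Res = \int[mu]_s (rn s)%:E)%E.
  rewrite /L1_norm integral_mkcond; apply: eq_integral => s _.
  rewrite /patch mem_setE in_itv/= andbT /rn; case: ifP => // s0.
  have r0 : 0 <= - r s by rewrite oppr_ge0 resolvent_le0.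
  by rewrite ResE// /= (max_idPl r0) ger0_norm.
have rn_bound A : (\int[mu]_s (if s <= A then rn s else 0)%:E <= (rho / (1 -
  rho))%:E)%E.
  have := renewal_inequality mrn rn0 rn_lt0 ler01 (resolvent_part_fin A rn_le
    rn_lt0 mrn).
  rewrite mul1r; apply => t t0; by rewrite mul1r rn_conv.
have Ifin : (\int[mu]_s (rn s)%:E < +oo)%E.
  apply: (@le_lt_trans _ _ (rho / (1 - rho))%:E); last by rewrite ltry.
  have -> : (\int[mu]_s (rn s)%:E =
      limn (fun k => \int[mu]_s (if (s <= k%:R)%R then rn s else 0%R)%:E))%E.
    rewrite -monotone_convergence//.
    - apply: eq_integral => s _; apply/esym/cvg_lim => //.
      apply: cvg_near_cst; exists (Num.truncn s).+1 => // k /= sk.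
      rewrite ifT// (le_trans (ltW (truncnS_gt _)))// ler_nat//.
    - move=> k; apply/measurable_EFinP; apply: measurable_fun_ifT => //.
      exact: measurable_fun_ler.
    - by move=> k s _; case: ifP; rewrite lee_fin.
    - move=> s _ i j ij; case: ifPn => [si|_]; last by case: ifP; rewrite lee_fin.
      by rewrite ifT// (le_trans si)// ler_nat.
  apply: lime_le; last by apply: nearW => k; exact: rn_bound.
  apply: ereal_nondecreasing_is_cvgn => i j ij; apply: ge0_le_integral => //.
  - by move=> s _; case: ifP; rewrite lee_fin.
  - by apply/measurable_EFinP; apply: measurable_fun_ifT => //;
    exact: measurable_fun_ler.
  - by apply/measurable_EFinP; apply: measurable_fun_ifT => //;
    exact: measurable_fun_ler.
  - move=> s _; case: ifPn => [si|_]; last by case: ifP; rewrite lee_fin.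
    by rewrite ifT// (le_trans si)// ler_nat.
have If : (\int[mu]_s (rn s)%:E)%E \is a fin_num.
  by rewrite ge0_fin_numE// integral_ge0// => s _; rewrite lee_fin.
have : (\int[mu]_s (rn s)%:E = rho%:E * \int[mu]_s (rn s)%:E + rho%:E)%E.
  rewrite -integral_conv_ge0// -F_int -ge0_integralD//.
  - by apply: eq_integral => s _; exact: rn_convT.
  - by move=> s _; exact: conv_ge0_ge0.
  - exact: measurable_conv_ge0.
  - by move=> s _; rewrite lee_fin.
  - exact/measurable_EFinP.
rewrite L1E -(fineK If) -EFinM -EFinD => -[H]; congr EFin.
apply: (mulIf (x := 1 - rho)); first by rewrite gt_eqF// subr_gt0.
rewrite divfK; last by rewrite gt_eqF// subr_gt0.
by rewrite mulrBr mulr1 {1}H; ring.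
Qed.

End resolvent.

(** * The stopped Hawkes process and its compensator formula *)

Section hawkes.
Context (R : realType) (d dX : measure_display).
Context (Omega : measurableType d) (X : measurableType dX).
Context (P : probability Omega R) (Q : probability X R).
Variables (m : R) (f : R -> X -> R).
Hypothesis m_ge0 : 0 <= m.
Hypothesis f_ge0 : forall (t : R) x, 0 <= t -> 0 <= f t x.
Hypothesis f_measurable : measurable_fun
       (`[0, +oo[%classic `*` setT : set (measurableTypeR R * X))
       (fun z : measurableTypeR R * X => f z.1 z.2).
Context (T : nat -> Omega -> \bar R) (M : nat -> Omega -> option X).
Hypothesis TM : marked_point_process T M.
Variable kappa : Omega -> R -> {measure set X -> \bar R}.
Let N := point_measure T M.
Let Fil := natural_filtration N.
Hypothesis N_kappa : has_compensator_kernel P Fil N kappa.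
Hypothesis kappaE : forall w t (A : set X), 0 <= t -> measurable A ->
      (kappa w t A =
       (m%:E + \int[point_measure T M w]_(z in `]0%R, t[%classic `*` setT)
                 (f (t - z.1)%R z.2)%:E) * Q A)%E.

(** Nothing is assumed of f at negative times; the extension by 0 is measurable on the whole product
    and allows integration over the whole line. *)
Definition ext0 (f : R -> X -> R) t x := if 0 <= t then f t x else 0.
Local Notation f0 := (ext0 f).
Local Notation tau := (tau T).
Local Notation xi := (xi M).

(* The density of kappa on 0 < s <= min (t, T_n), where it involves at most the
   first n points and is therefore bounded; 0 elsewhere. *)
Definition intensity n t w (s : R) : R :=
  if [&& 0 < s, s <= t & (s%:E <= T n w)%E] then
    m + \sum_(k < n.+1) (if (T k w < s%:E)%E then f0 (s - tau k w) (xi k w) else 0)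
  else 0.

Lemma ext0_ge0 t x : 0 <= f0 t x.
Proof. by rewrite /ext0; case: ifP => // /f_ge0. Qed.

Let f0_ge0 := ext0_ge0.

Lemma measurable_ext0 :
  measurable_fun setT (fun z : measurableTypeR R * X => f0 z.1 z.2).
Proof.
have mD : measurable (`[0, +oo[%classic `*` setT : set (measurableTypeR R * X)).
  by apply: measurableX => //; exact: measurable_itv.
have /(measurable_restrictT _ mD) := f_measurable; congr measurable_fun.
apply/funext => -[t x]; rewrite /ext0 /patch/= in_setX in_setT andbT.
by rewrite mem_setE in_itv/= andbT.
Qed.

Let mf0 := measurable_ext0.

Lemma intensity_ge0 n t w s : 0 <= intensity n t w s.
Proof.
rewrite /intensity; case: ifP => // _; rewrite addr_ge0// sumr_ge0// => k _.
by case: ifP => // _; exact: ext0_ge0.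
Qed.

Let lam_ge0 := intensity_ge0.

(** For s <= T n, neither [T n] nor any later point is strictly before s, so the series over all
    points stops before index n; the summand of index n in [intensity] is 0. *)
Lemma kappa_intensity n t w s (A : set X) : measurable A ->
  0 < s -> s <= t -> (s%:E <= T n w)%E ->
  (kappa w s A = (intensity n t w s)%:E * Q A)%E.
Proof.
move=> mA s0 st sT; rewrite kappaE ?ltW//; congr (_ * _)%E.
rewrite /intensity s0 st sT/= EFinD; congr (_ + _)%E.
have mD : measurable (`]0%R, s[%classic `*` setT : set (measurableTypeR R * X)).
  by apply: measurableX => //; exact: measurable_itv.
transitivity (\int[point_measure T M w]_(z in `]0%R, s[%classic `*` setT)
                 (f0 (s - z.1)%R z.2)%:E)%E.
  apply: eq_integral => -[r x];
    rewrite in_setX mem_setE in_itv/= => /andP[/andP[_ rs] _].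
  by rewrite /ext0 subr_ge0 ltW.
rewrite (integral_point_measure TM)//; last 2 first.
- apply: measurable_funTS; apply/measurable_EFinP.
  apply: (measurableT_comp measurable_ext0
    (g := fun z : measurableTypeR R * X => (s - z.1, z.2) : measurableTypeR R * X)).
  apply: measurable_fun_pair; last exact: measurable_snd.
  by apply: measurable_funB => //; exact: measurable_fst.
- by move=> z _; rewrite lee_fin ext0_ge0.
rewrite -sumEFin -(@nneseries_finite _ (fun k => (if (T k w < s%:E)%E then
    f0 (s - tau k w) (xi k w) else 0)%:E)).
- apply: eq_eseriesr => k _.
  by rewrite in_setX in_setT andbT (mpp_lt_itv TM); case: ifP.
- by move=> k; case: ifP => // _; rewrite lee_fin ext0_ge0.
- move=> k nk; rewrite ifF//; apply/negbTE; rewrite -leNgt.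
  by rewrite (le_trans sT)// (mpp_le_mono TM)// ltnW.
Qed.

Lemma intensityE n t w s : intensity n t w s =
  if [&& 0 < s, s <= t & (s%:E <= T n w)%E] then
    m + \sum_(k < n.+1) (if (T k w < s%:E)%E then f0 (s - tau k w) (xi k w) else 0)
  else 0.
Proof. by []. Qed.

(** The compensator identity for H cut to 0 < s <= min (t, T n), a predictable set. The cut keeps
    the point at [T n] itself, hence n + 1 summands on the left. H is measurable in two senses:
    predictable for the identity, Borel in (s, x) for evaluating the integrals at fixed w. *)
Theorem campbell n t (H : Omega -> R -> X -> \bar R) :
  (forall w s x, 0 <= H w s x)%E ->
  (forall w, measurable_fun setT (fun z : measurableTypeR R * X => H w z.1 z.2)) ->
  measurable_fun [set: pmspace X Fil] (fun z => H z.1.1 z.1.2 z.2) ->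
  (\int[P]_w \sum_(k < n.+1)
     (if T k w <= t%:E then H w (tau k w) (xi k w) else 0) =
   \int[P]_w \int[lebesgue_measure]_s
     ((intensity n t w s)%:E * \int[Q]_x H w s x))%E.
Proof.
move=> H0 Hm Hp.
pose c w s := [&& 0 < s, s <= t & (s%:E <= T n w)%E].
pose H' w s x := if c w s then H w s x else 0%E.
have H'0 w s x : (0 <= H' w s x)%E by rewrite /H'; case: ifP.
have := (N_kappa.2 H'); move=> /(_ (fun w t x _ => H'0 w t x)).
have mc1 : measurable_fun [set: measurableTypeR R] (fun s => 0 < s).
  exact: measurable_fun_ltr.
have mc2 : measurable_fun [set: measurableTypeR R] (fun s => s <= t).
  exact: measurable_fun_ler.
have sigF := natural_filtration_sigma T M.
have H'p B : measurable B -> predictable_marked Fil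
    [set z | 0 <= z.1.2 /\ B (H' z.1.1 z.1.2 z.2)].
  move=> mB.
  have mH' : measurable_fun [set: pmspace X Fil] (fun z => H' z.1.1 z.1.2 z.2).
    apply: measurable_fun_ifT => //.
    have m1 : measurable_fun [set: pmspace X Fil] (fun z => z.1.2 :
      measurableTypeR R).
      by apply: (measurableT_comp (measurable_pspace_snd sigF));
        exact: measurable_pmspace_fst.
    apply: measurable_and; first exact: (measurableT_comp mc1).
    apply: measurable_and; first exact: (measurableT_comp mc2).
    apply: (measurable_fun_bool true).
    have H1 := @measurable_pmspace_fst _ _ _ _ X Fil.
    have := H1 measurableT _ (measurable_pspace_stop TM n).
    by congr measurable; apply/seteqP; split => z /= [].
  have /measurable_pmspaceE := mH' measurableT _ mB.
  rewrite setTI; congr (predictable_marked Fil _); apply/seteqP;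
    split => -[[w s] x] /=.
    by rewrite in_itv/= andbT => -[? [[_ ?] _]].
  by rewrite in_itv/= andbT => -[? ?].
move=> /(_ H'p) HH.
transitivity (\int[P]_w \int[N w]_(z in `[0%R, +oo[ `*` setT) H' w z.1 z.2)%E.
  apply: eq_integral => w _.
  have mD : measurable (`[0%R, +oo[%classic `*` setT : set (measurableTypeR R * X)).
    by apply: measurableX => //; exact: measurable_itv.
  rewrite (integral_point_measure TM)//; last first.
    apply: measurable_funTS; apply: measurable_fun_ifT => //.
    apply: measurable_and; first by apply: (measurableT_comp mc1);
      exact: measurable_fst.
    apply: measurable_and; first by apply: (measurableT_comp mc2);
      exact: measurable_fst.
    apply: measurable_fun_lee => //.
    by apply/measurable_EFinP; exact: measurable_fst.
  have inD k : (T k w < +oo)%E -> (tau k w, xi k w) \in (`[0, +oo[%classic `*`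
    [set: X]).
    move=> Tk; rewrite in_setX in_setT andbT mem_setE in_itv/= andbT.
    by rewrite ltW// -lte_fin -(mpp_EFin_tau TM Tk) (mpp_time_gt0 TM).
  rewrite (@nneseries_finite _ _ n.+1).
  - apply: eq_bigr => k _.
    have [Tk|Tk] := boolP (T k w < +oo)%E; last first.
      by rewrite /= ifF//; apply: contraNF Tk => /le_lt_trans; apply; rewrite ltry.
    have TE := mpp_EFin_tau TM Tk.
    have E1 : 0 < tau k w by rewrite -lte_fin -TE (mpp_time_gt0 TM).
    have E2 : (T k w <= t%:E)%E = (tau k w <= t) by rewrite TE lee_fin.
    rewrite inD//= /H' /c E1 E2/= -TE.
    by rewrite (mpp_le_mono TM) ?andbT// -ltnS.
  - by move=> k; case: ifP.
  - move=> k nk; case: ifPn => // /andP[Tk _].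
    rewrite /H' /c ifF//; apply/negbTE;
      rewrite -(mpp_EFin_tau TM Tk) (mpp_leE TM)//.
    by rewrite leqNgt nk !andbF.
rewrite HH; apply: eq_integral => w _.
rewrite integral_mkcond; apply: eq_integral => s _.
rewrite /patch mem_setE in_itv/= andbT.
have [cs|cs] := boolP (c w s); last first.
  rewrite [X in if _ then X else _](_ : _ = 0%E); last first.
    by apply: integral0_eq => x _; rewrite /H' (negbTE cs).
  by rewrite if_same /intensity ifF ?mul0e//; exact: negbTE cs.
move: (cs) => /and3P[s0 st sT]; rewrite ltW//.
rewrite (eq_measure_integral (mscale (NngNum (intensity_ge0 n t w s)) Q));
  last first.
  by move=> A mA _; rewrite /mscale/= (kappa_intensity mA s0 st sT).
have -> : H' w s = H w s by apply/funext => x; rewrite /H' cs.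
rewrite ge0_integral_mscale//=.
exact: (measurable_fun_pair2 s (Hm w)).
Qed.

Local Notation mu := (@lebesgue_measure R).

Lemma measurable_intensity n t : measurable_fun setT
  (fun z : Omega * measurableTypeR R => intensity n t z.1 z.2).
Proof.
have mT k : measurable_fun [set: Omega * measurableTypeR R] (fun z => T k z.1).
  by apply: (measurableT_comp (mpp_time_measurable TM k)); exact: measurable_fst.
have ms : measurable_fun [set: Omega * measurableTypeR R] (fun z => z.2).
  exact: measurable_snd.
under eq_fun do rewrite intensityE.
apply: measurable_fun_ifT => //.
  apply: measurable_and; first exact: measurable_fun_ltr.
  apply: measurable_and; first exact: measurable_fun_ler.
  by apply: measurable_fun_lee => //; exact/measurable_EFinP.
apply: measurable_funD => //; apply: measurable_sum => k.
apply: measurable_fun_ifT => //.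
  by apply: measurable_fun_lte => //; exact/measurable_EFinP.
apply: (measurableT_comp measurable_ext0
  (g := fun z : Omega * measurableTypeR R => (z.2 - tau k z.1, xi k z.1) :
    measurableTypeR R * X)).
apply: measurable_fun_pair.
  apply: measurable_funB => //.
  by apply: (measurableT_comp (measurable_tau TM k)); exact: measurable_fst.
by apply: (measurableT_comp (measurable_xi TM k)); exact: measurable_fst.
Qed.

(** This bound grows with n and serves only to make suprema and moments finite. *)
Lemma intensity_le_bound n t (C : R) w s :
  (forall (t : R) x, 0 <= t -> f t x <= C) -> 0 <= C ->
  intensity n t w s <= m + n.+1%:R * C.
Proof.
move=> fC C0; rewrite intensityE; case: ifP => _;
  last by rewrite addr_ge0// mulr_ge0.
rewrite lerD2l; apply: (@le_trans _ _ (\sum_(k < n.+1) C)); last first.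
  by rewrite sumr_const card_ord mulr_natl.
apply: ler_sum => k _.
by case: ifP => // _; rewrite /ext0; case: ifP => // /fC.
Qed.

Lemma intensity_supp n t w s : ~~ (0 < s <= t) -> intensity n t w s = 0.
Proof. by rewrite intensityE => st; rewrite andbA (negbTE st). Qed.

Definition mean_intensity n t s : \bar R := (\int[P]_w (intensity n t w s)%:E)%E.

Lemma measurable_mean_intensity n t :
  measurable_fun [set: measurableTypeR R] (mean_intensity n t).
Proof.
apply: (measurable_fun_fubini_tonelli_G (m1 := P)
  (fun z : Omega * measurableTypeR R => (intensity n t z.1 z.2)%:E)).
- by apply/measurable_EFinP; exact: measurable_intensity.
- by move=> z; rewrite lee_fin intensity_ge0.
Qed.

Lemma mean_intensity_ge0 n t s : (0 <= mean_intensity n t s)%E.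
Proof. by apply: integral_ge0 => w _; rewrite lee_fin intensity_ge0. Qed.

Lemma measurable_integral_mark (h : measurableTypeR R * X -> \bar R) :
  measurable_fun setT h -> (forall z, 0 <= h z)%E ->
  measurable_fun [set: measurableTypeR R] (fun s => \int[Q]_x h (s, x))%E.
Proof. by move=> mh h0; exact: (measurable_fun_fubini_tonelli_F (m2 := Q) h). Qed.

Lemma campbell_det n t (h : measurableTypeR R * X -> \bar R) :
  measurable_fun setT h -> (forall z, 0 <= h z)%E ->
  (\int[P]_w \sum_(k < n.+1)
     (if T k w <= t%:E then h (tau k w, xi k w) else 0) =
   \int[mu]_s (mean_intensity n t s * \int[Q]_x h (s, x)))%E.
Proof.
move=> mh h0.
rewrite (campbell n t (H := fun w s x => h (s, x)))//.
- rewrite (fubini_tonelli (m1 := P) (m2 := mu)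
    (fun z : Omega * measurableTypeR R => (intensity n t z.1 z.2)%:E * \int[Q]_x
      h (z.2, x))%E).
  + apply: eq_integral => s _; rewrite /= ge0_integralZr//.
    * apply/measurable_EFinP.
      exact: (measurable_fun_pair1 s (measurable_intensity n t)).
    * by move=> w _; rewrite lee_fin intensity_ge0.
    * exact: integral_ge0.
  + apply: emeasurable_funM.
      by apply/measurable_EFinP; exact: measurable_intensity.
    by apply: (measurableT_comp (measurable_integral_mark mh h0));
      exact: measurable_snd.
  + by move=> z; rewrite mule_ge0// ?lee_fin ?intensity_ge0//; exact: integral_ge0.
- by move=> w; under eq_fun do rewrite -surjective_pairing.
- have sigF := natural_filtration_sigma T M.
  apply: (measurableT_comp mh (g := fun z : pmspace X Fil => (z.1.2, z.2) :
    measurableTypeR R * X)).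
  apply: measurable_fun_pair.
    by apply: (measurableT_comp (measurable_pspace_snd sigF));
      exact: measurable_pmspace_fst.
  exact: measurable_pmspace_snd.
Qed.

(** This is F, extended by 0 to negative times. *)
Definition mean_excitation s : \bar R := (\int[Q]_x (f0 s x)%:E)%E.

Lemma mean_excitation_ge0 s : (0 <= mean_excitation s)%E.
Proof. by apply: integral_ge0 => x _; rewrite lee_fin. Qed.

Lemma measurable_mean_excitation : measurable_fun [set: measurableTypeR R]
  mean_excitation.
Proof.
apply: (measurable_integral_mark (h := fun z => (f0 z.1 z.2)%:E)).
  exact/measurable_EFinP.
by move=> z; rewrite lee_fin.
Qed.

(** The intensity at u is at most m plus the sum of f(u - s, x) over the stopped points, whose
    expectation is given by the compensator formula. Only an inequality, because the intensity is
    cut to 0 beyond min (t, T n). *)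
Lemma mean_intensity_renewal n t u :
  (mean_intensity n t u <=
   m%:E + \int[mu]_s (mean_intensity n t s * mean_excitation (u - s)%R))%E.
Proof.
pose h (z : measurableTypeR R * X) := (f0 (u - z.1) z.2)%:E.
have mh : measurable_fun setT h.
  apply/measurable_EFinP.
  apply: (measurableT_comp measurable_ext0
    (g := fun z : measurableTypeR R * X => (u - z.1, z.2) : measurableTypeR R * X)).
  apply: measurable_fun_pair; last exact: measurable_snd.
  by apply: measurable_funB => //; exact: measurable_fst.
have h0 z : (0 <= h z)%E by rewrite lee_fin.
have := campbell_det n t mh h0 => /= <-.
have mS : measurable_fun [set: Omega]
    (fun w => \sum_(k < n.+1) if (T k w <= t%:E)%E then h (tau k w, xi k w) else
      0)%E.
  apply: emeasurable_sum => k; apply: measurable_fun_ifT => //.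
    by apply: measurable_fun_lee => //; exact: (mpp_time_measurable TM).
  apply: (measurableT_comp mh); apply: measurable_fun_pair.
    exact: (measurable_tau TM).
  exact: (measurable_xi TM).
have S0 w : (0 <= \sum_(k < n.+1) if (T k w <= t%:E)%E then h (tau k w, xi k w)
  else 0)%E.
  by apply: sume_ge0 => k _; case: ifP.
have Em : (m%:E = \int[P]_w m%:E)%E by rewrite integral_probability_cst.
rewrite {1}Em -ge0_integralD//.
apply: ge0_le_integral => //.
- by move=> w _; rewrite lee_fin.
- by apply/measurable_EFinP;
  exact: (measurable_fun_pair1 u (measurable_intensity n t)).
- exact: emeasurable_funD.
move=> w _; rewrite intensityE; case: ifPn => [/and3P[u0 ut uT]|_]; last first.
  by rewrite adde_ge0// lee_fin.
rewrite EFinD leeD2l// -sumEFin; apply: lee_sum => k _.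
case: ifPn => [Tu|_]; last by case: ifP.
by rewrite ifT// (le_trans (ltW Tu)).
Qed.

(** * First-moment bounds uniform in the stopping index *)

Section bounded.
Variables (C rho : R).
Hypothesis C0 : 0 <= C.
Hypothesis fC : forall (t : R) x, 0 <= t -> f t x <= C.
Hypothesis rhoE : (\int[mu]_s mean_excitation s = rho%:E)%E.
Hypothesis rho1 : rho < 1.

(** The supremum beta over u is finite by the crude bound in n and satisfies beta <= m + beta rho,
    since F has mass rho; finiteness allows solving for beta, and n disappears. *)
Lemma mean_intensity_bound n t u : (mean_intensity n t u <= (m / (1 - rho))%:E)%E.
Proof.
pose beta := ereal_sup (range (mean_intensity n t)).
have beta_ub s : (mean_intensity n t s <= beta)%E by apply: ereal_sup_ubound;
  exists s.
have beta0 : (0 <= beta)%E by apply: le_trans (beta_ub 0);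
  exact: mean_intensity_ge0.
have betaB : (beta <= (m + n.+1%:R * C)%:E)%E.
  apply: ge_ereal_sup => _ [s _ <-].
  rewrite -(integral_probability_cst P (m + n.+1%:R * C)%:E).
  apply: ge0_le_integral => //.
  - by move=> w _; rewrite lee_fin.
  - by apply/measurable_EFinP;
    exact: (measurable_fun_pair1 s (measurable_intensity n t)).
  - by move=> w _; rewrite lee_fin intensity_le_bound.
have bfin : beta \is a fin_num by rewrite ge0_fin_numE// (le_lt_trans betaB) ?ltry.
apply: le_trans (beta_ub u) _.
have mF' s : measurable_fun [set: measurableTypeR R] (fun s0 => mean_excitation
  (s - s0)).
  by apply: (measurableT_comp measurable_mean_excitation); exact: measurable_subl.
have : (beta <= m%:E + beta * rho%:E)%E.
  apply: ge_ereal_sup => _ [s _ <-].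
  apply: le_trans (mean_intensity_renewal _ _ _) _; rewrite leeD2l//.
  rewrite -rhoE -(ge0_integral_subl s measurable_mean_excitation)//;
    last exact: mean_excitation_ge0.
  rewrite -ge0_integralZl//; last by move=> *; exact: mean_excitation_ge0.
  apply: ge0_le_integral => //.
  - by move=> *; rewrite mule_ge0// ?mean_excitation_ge0// mean_intensity_ge0.
  - by apply: emeasurable_funM => //; exact: measurable_mean_intensity.
  - exact: measurable_funeM.
  - by move=> s0 _; rewrite lee_wpmul2r// mean_excitation_ge0.
rewrite -(fineK bfin) -EFinM -EFinD !lee_fin => H.
rewrite ler_pdivlMr ?subr_gt0//; lra.
Qed.

Lemma integral_mean_intensity n t : 0 <= t ->
  (\int[mu]_s mean_intensity n t s <= (m / (1 - rho) * t)%:E)%E.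
Proof.
move=> t0.
rewrite (_ : mean_intensity n t = (mean_intensity n t) \_ `]0, t]%classic);
  last first.
  apply/funext => s; rewrite /patch mem_setE in_itv/=; case: ifPn => // st.
  by apply: integral0_eq => w _; rewrite intensity_supp.
rewrite -integral_mkcond.
apply: (@le_trans _ _ (\int[mu]_(s in `]0%R, t]) (m / (1 - rho))%:E)%E).
  apply: ge0_le_integral => //.
  - by move=> s _; exact: mean_intensity_ge0.
  - by apply: measurable_funTS; exact: measurable_mean_intensity.
  - by move=> s _; exact: mean_intensity_bound.
rewrite integral_cst//= lebesgue_measure_itv/= lte_fin.
case: ifPn => _; first by rewrite sube0 -EFinM.
by rewrite mule0 lee_fin mulr_ge0// divr_ge0// subr_ge0 ltW.
Qed.

(** The event says that all n + 1 points have occurred by t; Markov's inequality is applied to the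
    number of stopped points, whose mean is the integral of the mean intensity. *)
Lemma prob_time_le n t : 0 <= t ->
  (P [set w | T n w <= t%:E] <= (m / (1 - rho) * t / n.+1%:R)%:E)%E.
Proof.
move=> t0.
pose h (z : measurableTypeR R * X) := 1%:E%E : \bar R.
have mh : measurable_fun setT h by exact: measurable_cst.
have h0 z : (0 <= h z)%E by rewrite lee_fin ler01.
have := campbell_det n t mh h0.
under [X in _ = X -> _]eq_integral do
  rewrite /h integral_probability_cst mule1.
move=> E1; have := integral_mean_intensity n t0; rewrite -E1 => {}E1.
have mS : measurable_fun [set: Omega]
    (fun w => \sum_(k < n.+1) if (T k w <= t%:E)%E then h (tau k w, xi k w) else
      0)%E.
  apply: emeasurable_sum => k; apply: measurable_fun_ifT => //.
  by apply: measurable_fun_lee => //; exact: (mpp_time_measurable TM).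
have S0 w : (0 <= \sum_(k < n.+1) if (T k w <= t%:E)%E then h (tau k w, xi k w)
  else 0)%E.
  by apply: sume_ge0 => k _; case: ifP.
have := markov_ge0 P mS S0 (ler0n _ n.+1) => /le_trans /(_ E1).
rewrite (_ : [set w | (n.+1%:R%:E <= _)%E] = [set w | (T n w <= t%:E)%E]);
  last first.
  have sum1 k : (\sum_(i < k) 1%:E = k%:R%:E :> \bar R)%E.
    by rewrite sumEFin sumr_const card_ord.
  apply/seteqP; split => w /=; rewrite /h; last first.
    move=> Tn; rewrite -sum1; apply: lee_sum => k _; rewrite ifT//.
    by rewrite (le_trans _ Tn)// (mpp_le_mono TM)// -ltnS.
  apply: contraTT => /negbTE Tn; rewrite -ltNge big_ord_recr/= Tn adde0.
  apply: (@le_lt_trans _ _ n%:R%:E%E); last by rewrite lte_fin ltr_nat.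
  by rewrite -sum1; apply: lee_sum => k _; case: ifP.
by rewrite -lee_pdivlMl ?ltr0n// -EFinM mulrC.
Qed.

(** * Second moment of the compensated sum over stopped points *)

Section square.
Variables (n : nat) (t : R).
Hypothesis t_ge0 : 0 <= t.
Variables (h : X -> R) (c v : R).
Hypothesis h_ge0 : forall x, 0 <= h x.
Hypothesis mh : measurable_fun setT h.
Hypothesis hc : (\int[Q]_x (h x)%:E = c%:E)%E.
Hypothesis hv : (\int[Q]_x ((h x) ^+ 2)%:E = v%:E)%E.

Local Notation lam := (intensity n t).

(** The value of D^h at time min (t, T n); below, [cumul_intensity] is Lambda at that same time. *)
Definition stopped_sum w : R :=
  \sum_(k < n.+1) if (T k w <= t%:E)%E then h (xi k w) else 0.

Definition stopped_sum_left (z : Omega * measurableTypeR R) : R :=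
  \sum_(k < n.+1) if (T k z.1 < z.2%:E)%E then h (xi k z.1) else 0.

Definition cumul_intensity w : \bar R := (\int[mu]_s (lam w s)%:E)%E.

Lemma cumul_ge0 w : (0 <= cumul_intensity w)%E.
Proof. by apply: integral_ge0 => s _; rewrite lee_fin. Qed.

Lemma measurable_cumul : measurable_fun setT cumul_intensity.
Proof.
apply: (measurable_fun_fubini_tonelli_F (m2 := mu)
  (fun z : Omega * measurableTypeR R => (lam z.1 z.2)%:E)).
- by apply/measurable_EFinP; exact: measurable_intensity.
- by move=> z; rewrite lee_fin.
Qed.

Lemma cumul_bound w : (cumul_intensity w <= ((m + n.+1%:R * C) * t)%:E)%E.
Proof.
rewrite /cumul_intensity (_ : (fun s => _) =
    (fun s => (lam w s)%:E) \_ `]0, t]%classic); last first.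
  apply/funext => s; rewrite /patch mem_setE in_itv/=; case: ifPn => // st.
  by rewrite intensity_supp.
rewrite -integral_mkcond.
apply: (@le_trans _ _ (\int[mu]_(s in `]0%R, t]) (m + n.+1%:R * C)%:E)%E).
  apply: ge0_le_integral => //.
  - by move=> s _; rewrite lee_fin.
  - apply: measurable_funTS; apply/measurable_EFinP.
    exact: (measurable_fun_pair2 w (measurable_intensity n t)).
  - by move=> s _; rewrite lee_fin intensity_le_bound.
rewrite integral_cst//= lebesgue_measure_itv/= lte_fin.
case: ifPn => _; first by rewrite sube0 -EFinM.
by rewrite mule0 lee_fin mulr_ge0// addr_ge0// mulr_ge0.
Qed.

Lemma cumul_fin w : cumul_intensity w \is a fin_num.
Proof. by rewrite ge0_fin_numE ?cumul_ge0// (le_lt_trans (cumul_bound w)) ?ltry.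
  Qed.

Lemma integral_cumul : (\int[P]_w cumul_intensity w = \int[mu]_s mean_intensity n
  t s)%E.
Proof.
apply: (fubini_tonelli (m1 := P) (m2 := mu)
  (fun z : Omega * measurableTypeR R => (lam z.1 z.2)%:E)).
- by apply/measurable_EFinP; exact: measurable_intensity.
- by move=> z; rewrite lee_fin.
Qed.

Lemma mark_mean_ge0 : 0 <= c.
Proof. by rewrite -lee_fin -hc integral_ge0// => x _; rewrite lee_fin. Qed.

Lemma mark_square_ge0 : 0 <= v.
Proof. by rewrite -lee_fin -hv integral_ge0// => x _; rewrite lee_fin sqr_ge0. Qed.

Lemma measurable_stopped_sum : measurable_fun setT stopped_sum.
Proof.
apply: measurable_sum => k; apply: measurable_fun_ifT => //.
  by apply: measurable_fun_lee => //; exact: (mpp_time_measurable TM).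
exact: (measurableT_comp mh (measurable_xi TM k)).
Qed.

Lemma stopped_sum_ge0 w : 0 <= stopped_sum w.
Proof. by apply: sumr_ge0 => k _; case: ifP. Qed.

Lemma measurable_stopped_sum_left : measurable_fun setT stopped_sum_left.
Proof.
apply: measurable_sum => k; apply: measurable_fun_ifT => //.
  apply: measurable_fun_lte.
    by apply: (measurableT_comp (mpp_time_measurable TM k)); exact: measurable_fst.
  by apply/measurable_EFinP; exact: measurable_snd.
apply: (measurableT_comp mh (g := fun z : Omega * measurableTypeR R => xi k z.1)).
by apply: (measurableT_comp (measurable_xi TM k)); exact: measurable_fst.
Qed.

Lemma stopped_sum_left_ge0 z : 0 <= stopped_sum_left z.
Proof. by apply: sumr_ge0 => k _; case: ifP. Qed.

Let hE x := (h x)%:E.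

Let hE0 x : (0 <= hE x)%E. Proof. by rewrite lee_fin. Qed.

Let mhE : measurable_fun setT hE. Proof. exact/measurable_EFinP. Qed.

Lemma mark_sum_left_stopped w s : (s%:E <= T n w)%E ->
  mark_sum_left T M hE (w, s) = (stopped_sum_left (w, s))%:E.
Proof.
move=> sT; rewrite /mark_sum_left/= (@nneseries_finite _ _ n.+1).
- by rewrite -sumEFin; apply: eq_bigr => k _; case: ifP.
- by move=> k; case: ifP.
- move=> k nk; rewrite ifF//; apply/negbTE; rewrite -leNgt.
  by rewrite (le_trans sT)// (mpp_le_mono TM)// ltnW.
Qed.

Lemma integral_stopped_sum :
  (\int[P]_w (stopped_sum w)%:E = c%:E * \int[mu]_s mean_intensity n t s)%E.
Proof.
transitivity (\int[P]_w \sum_(k < n.+1)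
     (if T k w <= t%:E then hE (xi k w) else 0))%E.
  by apply: eq_integral => w _; rewrite -sumEFin; apply: eq_bigr => k _; case: ifP.
rewrite (campbell_det n t (h := fun z => hE z.2)).
- under eq_integral do rewrite hc.
  rewrite ge0_integralZr//; last by rewrite lee_fin mark_mean_ge0.
  + by rewrite muleC.
  + exact: measurable_mean_intensity.
  + by move=> s _; exact: mean_intensity_ge0.
- by apply: (measurableT_comp mhE); exact: measurable_snd.
- by move=> z.
Qed.

(** The expectation of the integral of D^h_{s-} dLambda_s. It enters both E [D^2] and E [D Lambda];
    only its finiteness matters, its value is never computed. *)
Definition cross_moment : \bar R :=
  (\int[P]_w \int[mu]_s (lam w s * stopped_sum_left (w, s))%:E)%E.

Lemma cross_ge0 : (0 <= cross_moment)%E.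
Proof.
apply: integral_ge0 => w _; apply: integral_ge0 => s _.
by rewrite lee_fin mulr_ge0// stopped_sum_left_ge0.
Qed.

Lemma measurable_cross : measurable_fun setT
  (fun w => \int[mu]_s (lam w s * stopped_sum_left (w, s))%:E)%E.
Proof.
apply: (measurable_fun_fubini_tonelli_F (m2 := mu)
  (fun z : Omega * measurableTypeR R => (lam z.1 z.2 * stopped_sum_left z)%:E)).
- apply/measurable_EFinP; apply: measurable_funM; first exact: measurable_intensity.
  exact: measurable_stopped_sum_left.
- by move=> z; rewrite lee_fin mulr_ge0// stopped_sum_left_ge0.
Qed.

Lemma stopped_sum_left_le w s : (s <= t) -> stopped_sum_left (w, s) <=
  stopped_sum w.
Proof.
move=> st; apply: ler_sum => k _ /=; case: ifPn => [Tk|_]; last by case: ifP.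
by rewrite ifT// (le_trans (ltW Tk))// lee_fin.
Qed.

(** On s <= t the left limit is at most the final value of D^h, and Lambda is bounded by the
    constant B, so the moment is at most B E [D^h]. *)
Lemma cross_fin : cross_moment \is a fin_num.
Proof.
rewrite ge0_fin_numE ?cross_ge0//; pose B := (m + n.+1%:R * C) * t.
apply: (@le_lt_trans _ _ (\int[P]_w (B%:E * (stopped_sum w)%:E))%E).
  apply: ge0_le_integral => //.
  - move=> w _; apply: integral_ge0 => s _.
    by rewrite lee_fin mulr_ge0// stopped_sum_left_ge0.
  - exact: measurable_cross.
  - by apply: measurable_funeM; apply/measurable_EFinP;
    exact: measurable_stopped_sum.
  - move=> w _;
    apply: (@le_trans _ _ (cumul_intensity w * (stopped_sum w)%:E)%E); last first.
      by rewrite lee_wpmul2r ?lee_fin ?stopped_sum_ge0//; exact: cumul_bound.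
    have ml : measurable_fun [set: measurableTypeR R] (fun s => lam w s).
      exact: (measurable_fun_pair2 w (measurable_intensity n t)).
    rewrite /cumul_intensity -ge0_integralZr//; last 3 first.
      exact/measurable_EFinP.
      by move=> s _; rewrite lee_fin.
      by rewrite lee_fin stopped_sum_ge0.
    apply: ge0_le_integral => //.
    + by move=> s _; rewrite lee_fin mulr_ge0// stopped_sum_left_ge0.
    + apply/measurable_EFinP; apply: measurable_funM => //.
      exact: (measurable_fun_pair2 w measurable_stopped_sum_left).
    + by apply: emeasurable_funM => //; exact/measurable_EFinP.
    + move=> s _; rewrite -EFinM lee_fin.
      have [/andP[_ st]|st] := boolP (0 < s <= t); last first.
        by rewrite intensity_supp// !mul0r.
      by rewrite ler_wpM2l// stopped_sum_left_le.
rewrite ge0_integralZl//.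
- rewrite integral_stopped_sum muleA -EFinM.
  apply: (@le_lt_trans _ _ ((B * c)%:E * (m / (1 - rho) * t)%:E)%E).
    rewrite lee_wpmul2l ?integral_mean_intensity// lee_fin mulr_ge0
      ?mark_mean_ge0//.
    by rewrite mulr_ge0// addr_ge0// mulr_ge0.
  by rewrite -EFinM ltry.
- by apply/measurable_EFinP; exact: measurable_stopped_sum.
- by move=> w _; rewrite lee_fin stopped_sum_ge0.
- by rewrite lee_fin mulr_ge0// addr_ge0// mulr_ge0.
Qed.

(** The square telescopes over the jumps: a jump a from level S adds a^2 + 2 a S, where S is the
    left limit at the jump. *)
Lemma sum_jumps_sqr w :
  ((stopped_sum w ^+ 2)%:E = \sum_(k < n.+1) if T k w <= t%:E then
     (h (xi k w) ^+ 2)%:E + (2 * h (xi k w))%:E * mark_sum_left T M hE (w, tau k w)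
     else 0)%E.
Proof.
rewrite /stopped_sum.
pose a j : R := if (T j w <= t%:E)%E then h (xi j w) else 0.
have E1 (k : 'I_n.+1) : ((if T k w <= t%:E then
     (h (xi k w) ^+ 2)%:E + (2 * h (xi k w))%:E * mark_sum_left T M hE (w, tau k w)
     else 0) = (a k ^+ 2 + 2 * a k * \sum_(j < k) a j)%R%:E)%E.
  rewrite {1 2}/a.
  case: ifPn => Tk /=; last by rewrite expr0n/= mulr0 mul0r addr0.
  have Tfin : (T k w < +oo)%E by rewrite (le_lt_trans Tk)// ltry.
  rewrite EFinD; congr (_ + _)%E; rewrite [RHS]EFinM; congr (_ * _)%E.
  rewrite /mark_sum_left (@nneseries_finite _ _ k)/=.
  - rewrite -sumEFin; apply: eq_bigr => j _.
    rewrite -(mpp_EFin_tau TM Tfin) (mpp_ltE TM)// ltn_ord /a ifT//.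
    by rewrite (le_trans _ Tk)// (mpp_le_mono TM)// ltnW.
  - by move=> j; case: ifP.
  - by move=> j kj; rewrite -(mpp_EFin_tau TM Tfin) (mpp_ltE TM)// ltnNge kj.
transitivity (\sum_(k < n.+1) (a k ^+ 2 + 2 * a k * \sum_(j < k) a j)%R%:E)%E;
  last first.
  by apply: eq_bigr => k _; exact/esym/E1.
rewrite sumEFin; congr EFin; 
rewrite (eq_bigr (fun k : 'I_n.+1 => a k))//.
elim: n.+1 => [|l IH]; first by rewrite !big_ord0 expr0n.
by rewrite !big_ord_recr/= -IH sqrrD; ring.
Qed.

(** The compensator formula for h(x)^2 + 2 h(x) D_{s-}. The left limit over all points is used,
    being the one shown predictable; it agrees with the stopped one wherever the intensity is
    nonzero. *)
Lemma integral_stopped_sum_sqr :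
  (\int[P]_w (stopped_sum w ^+ 2)%:E =
   v%:E * (\int[mu]_s mean_intensity n t s) + (2 * c)%:E * cross_moment)%E.
Proof.
under eq_integral do rewrite sum_jumps_sqr.
have sigF := natural_filtration_sigma T M.
have mh2 : measurable_fun setT (fun x => h x ^+ 2) by exact: measurable_funX.
have m2h : measurable_fun setT (fun x => 2 * h x) by exact: measurable_funM.
have m2 (w : Omega) : measurable_fun [set: measurableTypeR R]
    (fun s => mark_sum_left T M hE (w, s)).
  apply: ge0_emeasurable_sum => k; first by move=> s _ _; case: ifP.
  by move=> _ /=; apply: measurable_fun_ifT => //; apply: measurable_fun_lte => //.

have ls0 z : (0 <= mark_sum_left T M hE z)%E.
  by apply: nneseries_ge0 => k _ _; case: ifP.
have m2h0 x : (0 <= (2 * h x)%:E)%E by rewrite lee_fin mulr_ge0.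
rewrite (campbell n t (H := fun w s x => (h x ^+ 2)%:E + (2 * h x)%:E *
  mark_sum_left T M hE (w, s))%E).
- transitivity (\int[P]_w (v%:E * cumul_intensity w + (2 * c)%:E *
      \int[mu]_s (lam w s * stopped_sum_left (w, s))%:E))%E.
    apply: eq_integral => w _.
    have ml : measurable_fun [set: measurableTypeR R] (fun s => lam w s).
      exact: (measurable_fun_pair2 w (measurable_intensity n t)).
    have mls : measurable_fun [set: measurableTypeR R] (fun s => stopped_sum_left
      (w, s)).
      exact: (measurable_fun_pair2 w measurable_stopped_sum_left).
    rewrite /cumul_intensity -!ge0_integralZl//.
    + rewrite -ge0_integralD//.
      * apply: eq_integral => s _.
        rewrite ge0_integralD//; last 4 first.
          by move=> x _; rewrite lee_fin sqr_ge0.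
          exact/measurable_EFinP.
          by move=> x _; rewrite mule_ge0.
          by apply: emeasurable_funM => //; exact/measurable_EFinP.
        rewrite hv ge0_integralZr//; last exact/measurable_EFinP.
        rewrite (_ : \int[Q]_x (2 * h x)%:E = (2 * c)%:E)%E; last first.
          under eq_integral do rewrite EFinM.
          rewrite ge0_integralZl//; last by move=> x _; rewrite lee_fin.
          by rewrite hc.
        have [/and3P[_ _ sT]|ns] := boolP [&& 0 < s, s <= t & (s%:E <= T n w)%E].
          rewrite mark_sum_left_stopped// -!EFinM -!EFinD; congr EFin; ring.
        by rewrite intensityE (negbTE ns) !mul0r !mule0 mul0e adde0.
      * by move=> s _; rewrite mule_ge0// lee_fin ?mark_square_ge0.
      * by apply: measurable_funeM; exact/measurable_EFinP.
      * by move=> s _;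
        rewrite mule_ge0// lee_fin mulr_ge0 ?mark_mean_ge0// stopped_sum_left_ge0.
      * by apply: measurable_funeM; apply/measurable_EFinP; exact: measurable_funM.
    + by apply/measurable_EFinP; exact: measurable_funM.
    + by move=> s _; rewrite lee_fin mulr_ge0// stopped_sum_left_ge0.
    + by rewrite lee_fin mulr_ge0// mark_mean_ge0.
    + exact/measurable_EFinP.
    + by move=> s _; rewrite lee_fin.
    + by rewrite lee_fin mark_square_ge0.
  rewrite ge0_integralD//.
  + rewrite !ge0_integralZl//.
    * by rewrite integral_cumul.
    * exact: measurable_cross.
    * move=> w _; apply: integral_ge0 => s _.
      by rewrite lee_fin mulr_ge0// stopped_sum_left_ge0.
    * by rewrite lee_fin mulr_ge0// mark_mean_ge0.
    * exact: measurable_cumul.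
    * by move=> w _; exact: cumul_ge0.
    * by rewrite lee_fin mark_square_ge0.
  + by move=> w _; rewrite mule_ge0 ?cumul_ge0// lee_fin mark_square_ge0.
  + by apply: measurable_funeM; exact: measurable_cumul.
  + move=> w _; rewrite mule_ge0 ?lee_fin ?mulr_ge0 ?mark_mean_ge0//.
    apply: integral_ge0 => s _.
    by rewrite lee_fin mulr_ge0// stopped_sum_left_ge0.
  + by apply: measurable_funeM; exact: measurable_cross.
- by move=> w s x; rewrite adde_ge0 ?mule_ge0// lee_fin sqr_ge0.
- move=> w; apply: emeasurable_funD.
    by apply/measurable_EFinP; apply: (measurableT_comp mh2); exact: measurable_snd.
  apply: emeasurable_funM.
    by apply/measurable_EFinP; apply: (measurableT_comp m2h); exact: measurable_snd.
  by apply: (measurableT_comp (m2 w)); exact: measurable_fst.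
- apply: emeasurable_funD.
    by apply/measurable_EFinP; apply: (measurableT_comp mh2);
      exact: measurable_pmspace_snd.
  apply: emeasurable_funM.
    by apply/measurable_EFinP; apply: (measurableT_comp m2h);
      exact: measurable_pmspace_snd.
  have := measurableT_comp (measurable_mark_sum_left TM mhE hE0)
    (@measurable_pmspace_fst _ _ _ _ X Fil).
  by congr measurable_fun; apply/funext => -[[w s] x].
Qed.

(** The increment of the stopped D^h over ]s, t], with s = [z.2]. *)
Definition stopped_sum_right (z : Omega * measurableTypeR R) : R :=
  \sum_(k < n.+1)
    if (T k z.1 <= t%:E)%E && (z.2 < tau k z.1) then h (xi k z.1) else 0.

Lemma measurable_stopped_sum_right : measurable_fun setT stopped_sum_right.
Proof.
apply: measurable_sum => k; apply: measurable_fun_ifT => //.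
  apply: measurable_and.
    apply: measurable_fun_lee => //.
    by apply: (measurableT_comp (mpp_time_measurable TM k)); exact: measurable_fst.
  apply: measurable_fun_ltr; first exact: measurable_snd.
  by apply: (measurableT_comp (measurable_tau TM k)); exact: measurable_fst.
apply: (measurableT_comp mh (g := fun z : Omega * measurableTypeR R => xi k z.1)).
by apply: (measurableT_comp (measurable_xi TM k)); exact: measurable_fst.
Qed.

Lemma stopped_sum_right_ge0 z : 0 <= stopped_sum_right z.
Proof. by apply: sumr_ge0 => k _; case: ifP. Qed.

Let measurable_lam w : measurable_fun [set: measurableTypeR R] (fun s => lam w s).
Proof. exact: (measurable_fun_pair2 w (measurable_intensity n t)). Qed.

(* Integration by parts for the product of the jump process and the continuous
   process; the diagonal s = T_k is Lebesgue-null. *)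
Lemma stopped_sum_cumul w : ((stopped_sum w)%:E * cumul_intensity w =
  \int[mu]_s (lam w s * stopped_sum_right (w, s))%:E +
  \int[mu]_s (lam w s * stopped_sum_left (w, s))%:E)%E.
Proof.
pose a k : R := if (T k w <= t%:E)%E then h (xi k w) else 0.
have a0 k : 0 <= a k by rewrite /a; case: ifP.
pose D k s : \bar R := (if s == tau k w then (lam w s * a k)%:E else 0)%E.
have D0 k s : (0 <= D k s)%E by rewrite /D; case: ifP => // _;
  rewrite lee_fin mulr_ge0.
have mD k : measurable_fun [set: measurableTypeR R] (D k).
  apply: measurable_fun_ifT => //; first exact: measurable_fun_eqr.
  by apply/measurable_EFinP; exact: measurable_funM.
have DI : (\int[mu]_s \sum_(k < n.+1) D k s = 0)%E.
  by rewrite ge0_integral_sum// big1// => k _; rewrite integral_lebesgue_diag.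
have mr : measurable_fun [set: measurableTypeR R] (fun s => (lam w s *
  stopped_sum_right (w, s))%:E).
  apply/measurable_EFinP; apply: measurable_funM => //.
  exact: (measurable_fun_pair2 w measurable_stopped_sum_right).
have ml : measurable_fun [set: measurableTypeR R] (fun s => (lam w s *
  stopped_sum_left (w, s))%:E).
  apply/measurable_EFinP; apply: measurable_funM => //.
  exact: (measurable_fun_pair2 w measurable_stopped_sum_left).
have r0 s : (0 <= (lam w s * stopped_sum_right (w, s))%:E)%E.
  by rewrite lee_fin mulr_ge0// stopped_sum_right_ge0.
have l0 s : (0 <= (lam w s * stopped_sum_left (w, s))%:E)%E.
  by rewrite lee_fin mulr_ge0// stopped_sum_left_ge0.
rewrite -[RHS]adde0 -DI -ge0_integralD//.
rewrite -ge0_integralD; [|by []|by move=> s _; rewrite adde_ge0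
  |exact: emeasurable_funD|by move=> s _; rewrite sume_ge0
  |exact: emeasurable_sum].
rewrite /cumul_intensity -ge0_integralZl//; last 3 first.
- exact/measurable_EFinP.
- by move=> s _; rewrite lee_fin.
- by rewrite lee_fin stopped_sum_ge0.
apply: eq_integral => s _.
have [/andP[s0 st]|ns] := boolP (0 < s <= t); last first.
  rewrite /D intensity_supp// mule0 !mul0r add0e.
  by rewrite big1 ?adde0// => k _; rewrite mul0r if_same.
rewrite -EFinM.
have -> : (\sum_(k < n.+1) D k s = (lam w s * \sum_(k < n.+1) if s == tau k w
  then a k else 0)%R%:E)%E.
  rewrite mulr_sumr -sumEFin; apply: eq_bigr => k _; rewrite /D.
  by case: ifP; rewrite ?mulr0.
rewrite -!EFinD -!mulrDr mulrC; congr (_ * _)%:E.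
rewrite /stopped_sum /stopped_sum_right /stopped_sum_left -!big_split/=.
apply: eq_bigr => k _; rewrite /a.
have [Tt|Tt] /= := boolP (T k w <= t%:E)%E; last first.
  rewrite if_same addr0 add0r ifF//; apply/negbTE;
    apply: contra Tt => /ltW/le_trans; apply.
  by rewrite lee_fin.
have Tfin : (T k w < +oo)%E by rewrite (le_lt_trans Tt)// ltry.
rewrite (mpp_EFin_tau TM Tfin) lte_fin.
by case: ltgtP => _; rewrite ?addr0 ?add0r.
Qed.

(** Predictability is read off from that of [kappa] on the full mark space, where Q has mass 1,
    rather than from the explicit sum. The guard 0 <= s is there because [kappa] is controlled only
    on that range. *)
Lemma measurable_pspace_intensity :
  measurable_fun [set: pspace Fil] (fun z => (lam z.1 z.2)%:E).
Proof.
have sigF := natural_filtration_sigma T M.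
have mk : measurable_fun [set: pspace Fil]
    (fun z => if 0 <= z.2 then kappa z.1 z.2 setT else 0%E).
  move=> _ B mB; rewrite setTI; apply/measurable_pspaceE.
  have := N_kappa.1 setT B measurableT mB; congr (predictable Fil _).
  apply/seteqP; split => -[w s] /=; rewrite in_itv/= andbT; first by case=> ->.
  by move=> [+ [_ s0]]; rewrite s0.
rewrite (_ : (fun z => _) = fun z : pspace Fil =>
  if [&& 0 < z.2, z.2 <= t & (z.2%:E <= T n z.1)%E] then
    (if 0 <= z.2 then kappa z.1 z.2 setT else 0%E) else 0%E).
  apply: measurable_fun_ifT => //.
  have ms := measurable_pspace_snd sigF.
  apply: measurable_and; first exact: measurable_fun_ltr.
  apply: measurable_and; first exact: measurable_fun_ler.
  apply: (measurable_fun_bool true); rewrite setTI.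
  exact: (measurable_pspace_stop TM n).
apply/funext => -[w s] /=; case: ifPn => [/and3P[s0 st sT]|ns]; last first.
  by rewrite intensityE (negbTE ns).
rewrite ltW//.
have := kappa_intensity measurableT s0 st sT.
by move=> ->; rewrite [X in (_ * X)%E](probability_setT Q) mule1.
Qed.

(* For a fixed s0 the integrand lam w s0 * 1_(s0 < s) is predictable in s, so the
   compensator formula applies for each s0 and Tonelli integrates over s0; this
   avoids proving that the cumulated intensity is itself predictable. *)
Lemma integral_stopped_sum_right s0 :
  (\int[P]_w (lam w s0 * stopped_sum_right (w, s0))%:E =
   \int[P]_w \int[mu]_s ((if s0 < s then lam w s0 * lam w s else 0) * c)%:E)%E.
Proof.
have [s0p|s0n] := boolP (0 < s0); last first.
  have l0 w : lam w s0 = 0 by rewrite intensity_supp// negb_and s0n.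
  rewrite !integral0_eq// => w _; last by rewrite l0 mul0r.
  by rewrite integral0_eq// => s _; rewrite l0 mul0r if_same mul0r.
have sigF := natural_filtration_sigma T M.
have mono := @natural_filtration_mono _ _ _ _ _ T M.
pose H w s x : \bar R := ((if (s0 < s)%R then (lam w s0)%:E else 0) * hE x)%E.
transitivity (\int[P]_w \sum_(k < n.+1)
     (if T k w <= t%:E then H w (tau k w) (xi k w) else 0))%E.
  apply: eq_integral => w _; rewrite mulr_sumr -sumEFin; apply: eq_bigr => k _ /=.
  rewrite /H; case: (T k w <= t%:E)%E => /=; last by rewrite mulr0.
  by case: ifP; rewrite ?mulr0 ?mul0e.
rewrite campbell /H.
- apply: eq_integral => w _; apply: eq_integral => s _.
  rewrite ge0_integralZl//; last by case: ifP; rewrite lee_fin.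
  rewrite hc; case: ifP => _; last by rewrite mul0e mule0 mul0r.
  by rewrite -!EFinM; congr EFin; ring.
- by move=> w s x; rewrite mule_ge0//; case: ifP; rewrite lee_fin.
- move=> w; apply: emeasurable_funM; last by apply: (measurableT_comp mhE);
  exact: measurable_snd.
  apply: measurable_fun_ifT => //; apply: measurable_fun_ltr => //;
    exact: measurable_fst.
- apply: emeasurable_funM; last by apply: (measurableT_comp mhE);
  exact: measurable_pmspace_snd.
  have := measurable_fun_pspace_freeze sigF mono (ltW s0p)
    measurable_pspace_intensity.
  by move=> /measurableT_comp /(_ (@measurable_pmspace_fst _ _ _ _ X Fil)).
Qed.

(** After integration by parts, the increments of D^h following s are replaced by c times those of
    Lambda. This leaves c times the integral of lam(s) lam(u) over s < u, which is c / 2 times the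
    square of Lambda. *)
Lemma integral_sum_cumul :
  (\int[P]_w ((stopped_sum w)%:E * cumul_intensity w) =
   (c / 2)%:E * (\int[P]_w (cumul_intensity w * cumul_intensity w)) +
     cross_moment)%E.
Proof.
have mR : measurable_fun [set: Omega * measurableTypeR R]
    (fun z => (lam z.1 z.2 * stopped_sum_right z)%:E).
  apply/measurable_EFinP; apply: measurable_funM; first exact: measurable_intensity.
  exact: measurable_stopped_sum_right.
have R0 z : (0 <= (lam z.1 z.2 * stopped_sum_right z)%:E)%E.
  by rewrite lee_fin mulr_ge0// stopped_sum_right_ge0.
pose K (p : (Omega * measurableTypeR R) * measurableTypeR R) : \bar R :=
  ((if p.1.2 < p.2 then lam p.1.1 p.1.2 * lam p.1.1 p.2 else 0) * c)%:E.
have K0 p : (0 <= K p)%E.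
  by rewrite lee_fin mulr_ge0 ?mark_mean_ge0//; case: ifP => // _; rewrite mulr_ge0.
have mK : measurable_fun setT K.
  have m1 : measurable_fun [set: (Omega * measurableTypeR R) * measurableTypeR R]
      (fun p => lam p.1.1 p.1.2).
    by apply: (measurableT_comp (measurable_intensity n t)); exact: measurable_fst.
  have m2 : measurable_fun [set: (Omega * measurableTypeR R) * measurableTypeR R]
      (fun p => lam p.1.1 p.2).
    apply: (measurableT_comp (measurable_intensity n t)
      (g := fun p : (Omega * measurableTypeR R) * measurableTypeR R => (p.1.1,
        p.2))).
    apply: measurable_fun_pair; last exact: measurable_snd.
    by apply: (measurableT_comp measurable_fst); exact: measurable_fst.
  apply/measurable_EFinP; apply: measurable_funM => //;
    apply: measurable_fun_ifT => //.
    apply: measurable_fun_ltr; last exact: measurable_snd.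
    by apply: (measurableT_comp measurable_snd); exact: measurable_fst.
  exact: measurable_funM.
transitivity (\int[P]_w \int[mu]_s (lam w s * stopped_sum_right (w, s))%:E +
  cross_moment)%E.
  under eq_integral do rewrite stopped_sum_cumul.
  rewrite ge0_integralD//.
  - by move=> w _; apply: integral_ge0 => s _; exact: (R0 (w, s)).
  - exact: (measurable_fun_fubini_tonelli_F (m2 := mu) _ mR).
  - move=> w _; apply: integral_ge0 => s _.
    by rewrite lee_fin mulr_ge0// stopped_sum_left_ge0.
  - exact: measurable_cross.
congr (_ + _)%E.
rewrite (fubini_tonelli (m1 := P) (m2 := mu) _ mR R0)/=.
under eq_integral do rewrite integral_stopped_sum_right.
have := fubini_tonelli (m1 := P) (m2 := mu) _
  (measurable_fun_fubini_tonelli_F (m2 := mu) K mK K0)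
  (fun z => integral_ge0 _ (fun x _ => K0 (z, x))).
rewrite /fubini_F/= => <-.
rewrite -ge0_integralZl//.
- apply: eq_integral => w _.
  have mlE : measurable_fun [set: measurableTypeR R] (fun s => (lam w s)%:E).
    exact/measurable_EFinP.
  have l0 s : (0 <= (lam w s)%:E)%E by rewrite lee_fin.
  rewrite /cumul_intensity (integral_sqr_triangle mlE l0) muleA -EFinM divfK//.
  pose Kw (z : measurableTypeR R * measurableTypeR R) : \bar R :=
    (if (z.1 < z.2)%R then (lam w z.1)%:E * (lam w z.2)%:E else 0)%E.
  have mKw : measurable_fun setT Kw.
    apply: measurable_fun_ifT => //.
      by apply: measurable_fun_ltr; [exact: measurable_fst|exact: measurable_snd].
    apply: emeasurable_funM; apply: (measurableT_comp mlE).
      exact: measurable_fst.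
    exact: measurable_snd.
  have Kw0 z : (0 <= Kw z)%E by rewrite /Kw; case: ifP => // _; rewrite mule_ge0.
  rewrite -ge0_integralZl ?lee_fin ?mark_mean_ge0//.
  + apply: eq_integral => s _; rewrite -ge0_integralZl ?lee_fin ?mark_mean_ge0//.
    * apply: eq_integral => u _; rewrite /K/=; case: ifP => _;
      last by rewrite mule0 mul0r.
      by rewrite -!EFinM mulrC.
    * exact: (measurable_fun_pair2 s mKw).
    * by move=> u _; exact: (Kw0 (s, u)).
  + exact: (measurable_fun_fubini_tonelli_F (m2 := mu) Kw mKw).
  + by move=> s _; apply: integral_ge0 => u _; exact: (Kw0 (s, u)).
- by apply: emeasurable_funM; exact: measurable_cumul.
- by move=> w _; rewrite mule_ge0// cumul_ge0.
- by rewrite lee_fin divr_ge0// mark_mean_ge0.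
Qed.

(* In the second moment of d - c L, the cross moment and E [L^2] cancel. *)
Lemma martingale_isometry :
  (\int[P]_w ((stopped_sum w - c * fine (cumul_intensity w)) ^+ 2)%:E =
   v%:E * \int[mu]_s mean_intensity n t s)%E.
Proof.
pose L w := fine (cumul_intensity w); pose S w := stopped_sum w.
have LE w : cumul_intensity w = (L w)%:E by rewrite fineK// cumul_fin.
have L0 w : 0 <= L w by rewrite fine_ge0// cumul_ge0.
have d0 w : 0 <= S w by exact: stopped_sum_ge0.
have mL : measurable_fun setT L by apply: measurableT_comp => //;
  exact: measurable_cumul.
have md : measurable_fun setT S by exact: measurable_stopped_sum.
pose B := (m + n.+1%:R * C) * t.
have LB w : L w <= B by rewrite -lee_fin -LE cumul_bound.
pose e := (\int[P]_w (cumul_intensity w * cumul_intensity w))%E.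
have e_fin : e \is a fin_num.
  rewrite ge0_fin_numE; last by apply: integral_ge0 => w _;
    rewrite mule_ge0// cumul_ge0.
  apply: (@le_lt_trans _ _ (B * B)%:E); last by rewrite ltry.
  rewrite -(integral_probability_cst P (B * B)%:E).
  apply: ge0_le_integral => //.
  - by move=> w _; rewrite mule_ge0// cumul_ge0.
  - by apply: emeasurable_funM; exact: measurable_cumul.
  - by move=> w _; rewrite LE -EFinM lee_fin ler_pM.
have c0 := mark_mean_ge0.
(* The product term is moved to the left, so that every integrand is non-negative and the integrals
   split without integrability conditions. *)
have E1 : (\int[P]_w ((S w - c * L w) ^+ 2 + 2 * c * (S w * L w))%:E =
          \int[P]_w (S w ^+ 2 + c ^+ 2 * (L w * L w))%:E)%E.
  by apply: eq_integral => w _; congr EFin; ring.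
have mdL : measurable_fun setT (fun w => S w * L w) by exact: measurable_funM.
have m1 : measurable_fun setT (fun w => (S w - c * L w) ^+ 2).
  by apply: measurable_funX; apply: measurable_funB => //; exact: measurable_funM.
have m2 : measurable_fun setT (fun w => S w ^+ 2) by exact: measurable_funX.
have mLL : measurable_fun setT (fun w => L w * L w) by exact: measurable_funM.
move: E1.
under eq_integral do rewrite EFinD (EFinM (2 * c)).
under [in RHS]eq_integral do rewrite EFinD (EFinM (c ^+ 2)).
rewrite ge0_integralD//; last 4 first.
- by move=> w _; rewrite lee_fin sqr_ge0.
- exact/measurable_EFinP.
- by move=> w _; rewrite -EFinM lee_fin !mulr_ge0.
- by apply: measurable_funeM; exact/measurable_EFinP.
rewrite ge0_integralD//; last 4 first.
- by move=> w _; rewrite lee_fin sqr_ge0.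
- exact/measurable_EFinP.
- by move=> w _; rewrite -EFinM lee_fin !mulr_ge0// sqr_ge0.
- by apply: measurable_funeM; exact/measurable_EFinP.
rewrite ge0_integralZl//; last 3 first.
- exact/measurable_EFinP.
- by move=> w _; rewrite lee_fin mulr_ge0.
- by rewrite lee_fin mulr_ge0.
rewrite ge0_integralZl//; last 3 first.
- exact/measurable_EFinP.
- by move=> w _; rewrite lee_fin mulr_ge0.
- by rewrite lee_fin sqr_ge0.
have -> : (\int[P]_w (S w * L w)%:E = (c / 2)%:E * e + cross_moment)%E.
  by rewrite -integral_sum_cumul; apply: eq_integral => w _; rewrite LE EFinM.
have -> : (\int[P]_w (L w * L w)%:E = e)%E.
  by apply: eq_integral => w _; rewrite LE EFinM.
rewrite integral_stopped_sum_sqr.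
set I1 := (\int[P]_w _)%E; set va := (v%:E * _)%E => E1.
(* The common part of both sides; it is a real number, so it can be subtracted. *)
pose y := (c ^+ 2 * fine e + 2 * c * fine cross_moment).
have Y1 : ((2 * c)%:E * ((c / 2)%:E * e + cross_moment) = y%:E)%E.
  transitivity (2 * c * (c / 2 * fine e + fine cross_moment))%:E.
    by rewrite -{1}(fineK e_fin) -{1}(fineK cross_fin).
  by congr EFin; rewrite /y; field.
have Y2 : ((2 * c)%:E * cross_moment + (c ^+ 2)%:E * e = y%:E)%E.
  by rewrite -(fineK e_fin) -(fineK cross_fin) -!EFinM -EFinD addrC.
move: E1; rewrite Y1 -(addeA va) Y2 => /(congr1 (fun x => x - y%:E)%E).
by rewrite !addeK.
Qed.

Lemma measurable_fine_cumul : measurable_fun setT (fun w => fine (cumul_intensity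
  w)).
Proof. by apply: measurableT_comp => //; exact: measurable_cumul. Qed.

(** Chebyshev's inequality. The bound does not involve n, which leaves n free to depend on t. *)
Lemma stopped_sum_deviation (delta : R) : 0 < delta ->
  (P [set w | (delta <= `|stopped_sum w - c * fine (cumul_intensity w)|)%R]
   <= (v * (m / (1 - rho) * t) / delta ^+ 2)%:E)%E.
Proof.
move=> delta0; pose Z w := stopped_sum w - c * fine (cumul_intensity w).
have mZ : measurable_fun setT (fun w => (Z w ^+ 2)%:E).
  apply/measurable_EFinP; apply: measurable_funX; apply: measurable_funB.
    exact: measurable_stopped_sum.
  by apply: measurable_funM => //; exact: measurable_fine_cumul.
have Z0 w : (0 <= (Z w ^+ 2)%:E)%E by rewrite lee_fin sqr_ge0.
have := markov_ge0 P mZ Z0 (sqr_ge0 delta); rewrite martingale_isometry => H.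
have : (v%:E * \int[mu]_s mean_intensity n t s <= (v * (m / (1 - rho) * t))%:E)%E.
  by rewrite EFinM lee_wpmul2l ?lee_fin ?mark_square_ge0//;
    exact: integral_mean_intensity.
move=> /(le_trans H); rewrite (_ : [set w | _] = [set w | delta <= `|Z w|]).
  by rewrite -lee_pdivlMl ?exprn_gt0// -EFinM [X in (_ <= X%:E)%E -> _]mulrC.
apply/seteqP; split => w /=; rewrite lee_fin -(real_normK (num_real (Z w)));
  by rewrite ler_pXn2r// ?nnegrE ?ltW.
Qed.

End square.

(** * Balance between the integrated intensity and the excitation after t *)

(** The L^1 norm of f(., x), with v = 0 left out to match the strict condition T k < s in the
    intensity. It may be +oo. *)
Definition total_excitation x : \bar R :=
  (\int[mu]_v (if (0 < v)%R then f0 v x else 0%R)%:E)%E.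

Lemma measurable_shifted_excitation (b : R -> R -> bool) :
  measurable_fun [set: measurableTypeR R * measurableTypeR R] (fun z => b z.1
    z.2) ->
  measurable_fun [set: (measurableTypeR R * X) * measurableTypeR R]
    (fun p => (if b p.1.1 p.2 then f0 (p.2 - p.1.1) p.1.2 else 0)%:E).
Proof.
move=> mb; have mfst : measurable_fun [set: (measurableTypeR R * X) *
  measurableTypeR R]
    (fun p => p.1.1).
  by apply: (measurableT_comp measurable_fst); exact: measurable_fst.
apply/measurable_EFinP; apply: measurable_fun_ifT => //.
  apply: (measurableT_comp mb
    (g := fun p : (measurableTypeR R * X) * measurableTypeR R => (p.1.1, p.2))).
  by apply: measurable_fun_pair => //; exact: measurable_snd.
apply: (measurableT_comp measurable_ext0
  (g := fun p : (measurableTypeR R * X) * measurableTypeR R =>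
    (p.2 - p.1.1, p.1.2) : measurableTypeR R * X)).
apply: measurable_fun_pair.
  by apply: measurable_funB => //; exact: measurable_snd.
by apply: (measurableT_comp measurable_snd); exact: measurable_fst.
Qed.

Section residual.
Variables (n : nat) (t : R).
Hypothesis t_ge0 : 0 <= t.

Definition future_excitation (z : measurableTypeR R * X) : \bar R :=
  (\int[mu]_v (if (t < v)%R then f0 (v - z.1) z.2 else 0%R)%:E)%E.

Lemma future_excitation_ge0 z : (0 <= future_excitation z)%E.
Proof. by apply: integral_ge0 => v _; case: ifP; rewrite lee_fin. Qed.

Lemma measurable_future_excitation : measurable_fun setT future_excitation.
Proof.
apply: (measurable_fun_fubini_tonelli_F (m2 := mu)
  (fun p : (measurableTypeR R * X) * measurableTypeR R =>
     (if (t < p.2)%R then f0 (p.2 - p.1.1) p.1.2 else 0%R)%:E)).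
  apply: (measurable_shifted_excitation (b := fun _ v => t < v)).
  by apply: measurable_fun_ltr => //; exact: measurable_snd.
by move=> p; case: ifP; rewrite lee_fin.
Qed.

(* The part of the total excitation of the points up to t that falls after t. *)
Definition residual w : \bar R :=
  (\sum_(k < n.+1) if T k w <= t%:E then future_excitation (tau k w, xi k w) else
    0)%E.

Lemma residual_ge0 w : (0 <= residual w)%E.
Proof. by apply: sume_ge0 => k _; case: ifP => // _;
  exact: future_excitation_ge0. Qed.

Lemma measurable_residual : measurable_fun setT residual.
Proof.
apply: emeasurable_sum => k; apply: measurable_fun_ifT => //.
  by apply: measurable_fun_lee => //; exact: (mpp_time_measurable TM).
apply: (measurableT_comp measurable_future_excitation).
by apply: measurable_fun_pair;
  [exact: (measurable_tau TM)|exact: (measurable_xi TM)].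
Qed.

Lemma mean_excitation_lt0 u : u < 0 -> mean_excitation u = 0%E.
Proof.
move=> u0; apply: integral0_eq => x _; rewrite /ext0 ifF//.
by apply/negbTE; rewrite -ltNge.
Qed.

(** A point at s contributes the integral of F(v - s) over v > t, on average over its mark. With u =
    v - s fixed, s ranges over part of ]t - u, t], of length at most u; hence the first moment of F,
    uniformly in t and n. *)
Lemma integral_residual : (\int[P]_w residual w <=
  (m / (1 - rho))%:E * \int[mu]_u (mean_excitation u * u%:E))%E.
Proof.
have c10 : (0 <= (m / (1 - rho))%:E)%E by rewrite lee_fin divr_ge0// subr_ge0 ltW.
(* Coordinates (s, u) with u = v - s, so that integrating first over s at fixed u gives a length. *)
pose G (z : measurableTypeR R * measurableTypeR R) : \bar R :=
  (if (0 < z.1 <= t)%R && (t < z.2 + z.1)%R then mean_excitation z.2 else 0)%E.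
have G0 z : (0 <= G z)%E by rewrite /G; case: ifP => // _;
  exact: mean_excitation_ge0.
have mG : measurable_fun setT G.
  apply: measurable_fun_ifT => //.
    apply: measurable_and; first apply: measurable_and.
    - by apply: measurable_fun_ltr => //; exact: measurable_fst.
    - by apply: measurable_fun_ler => //; exact: measurable_fst.
    - apply: measurable_fun_ltr => //; apply: measurable_funD;
      last exact: measurable_fst.
      exact: measurable_snd.
  by apply: (measurableT_comp measurable_mean_excitation); exact: measurable_snd.
rewrite (campbell_det n t measurable_future_excitation future_excitation_ge0).
apply: (@le_trans _ _ (\int[mu]_s ((m / (1 - rho))%:E * \int[mu]_u G (s, u)))%E).
  apply: ge0_le_integral => //.
  - move=> s _; rewrite mule_ge0 ?mean_intensity_ge0//.
    by apply: integral_ge0 => x _; exact: future_excitation_ge0.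
  - apply: emeasurable_funM; first exact: measurable_mean_intensity.
    exact: (measurable_integral_mark measurable_future_excitation
      future_excitation_ge0).
  - apply: measurable_funeM.
    exact: (measurable_fun_fubini_tonelli_F (m2 := mu) G mG).
  - move=> s _; have [st|st] := boolP (0 < s <= t); last first.
      rewrite (_ : mean_intensity n t s = 0%E) ?mul0e.
        by rewrite mule_ge0//; apply: integral_ge0.
      by apply: integral0_eq => w _; rewrite intensity_supp.
    apply: lee_pmul => //; first exact: mean_intensity_ge0.
    - by apply: integral_ge0 => x _; exact: future_excitation_ge0.
    - exact: mean_intensity_bound.
    have m1 : measurable_fun [set: X * measurableTypeR R]
        (fun z => (if (t < z.2)%R then f0 (z.2 - s) z.1 else 0%R)%:E).
      have := measurable_shifted_excitation (b := fun _ v => t < v).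
      move=> /(_ (measurable_fun_ltr (measurable_cst _) measurable_snd)) H.
      apply: (measurableT_comp H (g := fun z : X * measurableTypeR R => ((s,
        z.1), z.2))).
      apply: measurable_fun_pair; last exact: measurable_snd.
      by apply: measurable_fun_pair => //; exact: measurable_fst.
    rewrite /future_excitation/= (fubini_tonelli (m1 := Q) (m2 := mu) _ m1)/=;
      last first.
      by move=> z; case: ifP; rewrite lee_fin.
    rewrite -(ge0_integral_subr s (measurable_fun_pair2 s mG))//.
    rewrite le_eqVlt; apply/orP; left; apply/eqP; apply: eq_integral => v _.
    rewrite /G/= st/= subrK; case: ifP => // _.
    exact: integral0.
rewrite ge0_integralZl//; last 2 first.
- exact: (measurable_fun_fubini_tonelli_F (m2 := mu) G mG).
- by move=> s _; exact: integral_ge0.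
rewrite lee_wpmul2l// (fubini_tonelli (m1 := mu) (m2 := mu) G mG G0).
have mu0 u : (0 <= mean_excitation u * u%:E)%E.
  have [u0|u0] := leP 0 u; first by rewrite mule_ge0// mean_excitation_ge0.
  by rewrite mean_excitation_lt0// mul0e.
apply: ge0_le_integral => //.
- by move=> u _; exact: integral_ge0.
- exact: (measurable_fun_fubini_tonelli_G (m1 := mu) G mG).
- apply: emeasurable_funM; first exact: measurable_mean_excitation.
  exact: EFin_measurable.
move=> u _; have [u0|u0] := leP 0 u; last first.
  rewrite mean_excitation_lt0// mul0e integral0_eq// => s _.
  by rewrite /G/= mean_excitation_lt0// if_same.
apply: (@le_trans _ _ (\int[mu]_(s in `](t - u)%R, t]) mean_excitation u)%E).
  rewrite [leRHS]integral_mkcond; apply: ge0_le_integral => //.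
  - exact: (measurable_fun_pair1 u mG).
  - by apply/(measurable_restrictT _ _).1.
  - move=> s _; rewrite /patch mem_setE in_itv/= /G/=.
    case: ifPn => [/andP[/andP[_ st] ts]|_]; last by case: ifP => // _;
      exact: mean_excitation_ge0.
    by rewrite ifT// st andbT ltrBlDl.
rewrite integral_cst//= lebesgue_measure_itv/= lte_fin.
rewrite lee_wpmul2l ?mean_excitation_ge0//; case: ifP => _; last by rewrite lee_fin.
by rewrite -EFinB lee_fin opprB addrC subrK.
Qed.

(** Before [T n] the cut at the stopping time is invisible on ]0, t], so Lambda_t is m t plus the
    excitation of each point up to t; what that point produces after t completes it to its full L^1
    norm. *)
Lemma cumul_residual w : (t%:E < T n w)%E ->
  (cumul_intensity n t w + residual w = (m * t)%:E +
   \sum_(k < n.+1) if T k w <= t%:E then total_excitation (xi k w) else 0)%E.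
Proof.
move=> tT.
pose a (k : nat) (s : measurableTypeR R) : \bar R :=
  (if (0 < s <= t) && (T k w < s%:E)%E then f0 (s - tau k w) (xi k w) else 0)%:E.
have a0 k s : (0 <= a k s)%E by rewrite /a; case: ifP; rewrite lee_fin.
have mf k : measurable_fun [set: measurableTypeR R] (fun s => f0 (s - tau k w)
  (xi k w)).
  apply: (measurableT_comp measurable_ext0
    (g := fun s : measurableTypeR R => (s - tau k w, xi k w) : measurableTypeR R
      * X)).
  by apply: measurable_fun_pair => //; exact: measurable_funB.
have mpos : measurable_fun [set: measurableTypeR R] (fun s => 0 < s <= t).
  by apply: measurable_and; [exact: measurable_fun_ltr|exact: measurable_fun_ler].
have ma k : measurable_fun [set: measurableTypeR R] (a k).
  apply/measurable_EFinP; apply: measurable_fun_ifT => //;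
    apply: measurable_and => //.
  by apply: measurable_fun_lte => //; exact: EFin_measurable.
have cE : (cumul_intensity n t w = (m * t)%:E + \sum_(k < n.+1) \int[mu]_s a k s)%E.
  transitivity (\int[mu]_s ((if 0 < s <= t then m else 0)%R%:E + \sum_(k < n.+1)
    a k s))%E.
    apply: eq_integral => s _; rewrite intensityE.
    case: ifPn => [/and3P[s0 st sT]|ns].
      rewrite s0 st/= EFinD -sumEFin; congr (_ + _)%E; apply: eq_bigr => k _.
      by rewrite /a s0 st.
    have nst : (0 < s <= t) = false.
      apply/negbTE; apply: contra ns => /andP[-> st]; rewrite st/=.
      by rewrite ltW// (le_lt_trans _ tT)// lee_fin.
    by rewrite nst big1 ?adde0// => k _; rewrite /a nst.
  rewrite ge0_integralD//; last 4 first.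
  - by move=> s _; case: ifP; rewrite lee_fin.
  - by apply/measurable_EFinP; exact: measurable_fun_ifT.
  - by move=> s _; exact: sume_ge0.
  - exact: emeasurable_sum.
  rewrite ge0_integral_sum//; congr (_ + _)%E.
  transitivity (\int[mu]_(s in `]0%R, t]) m%:E)%E.
    rewrite [RHS]integral_mkcond; apply: eq_integral => s _.
    by rewrite /patch mem_setE in_itv/=; case: ifP.
  rewrite integral_cst//= lebesgue_measure_itv/= lte_fin; case: ifPn.
    by rewrite sube0 EFinM.
  rewrite -leNgt => tle; have -> : t = 0 by apply/eqP; rewrite eq_le tle.
  by rewrite mulr0 mule0.
rewrite cE -addeA -big_split/=; congr (_ + _)%E; apply: eq_bigr => k _.
case: ifPn => Tk; last first.
  rewrite adde0 integral0_eq// => s _; rewrite /a ifF//; apply/negbTE.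
  rewrite negb_and orbC -implybE; apply/implyP => Ts; apply/negP => /andP[_ st].
  by move: Tk; rewrite (le_trans (ltW Ts))// lee_fin.
have Tfin : (T k w < +oo)%E by rewrite (le_lt_trans Tk)// ltry.
have tau0 : 0 < tau k w by rewrite -lte_fin -(mpp_EFin_tau TM Tfin) (mpp_time_gt0
  TM).
have taut : tau k w <= t by rewrite -lee_fin -(mpp_EFin_tau TM Tfin).
have mg : measurable_fun [set: measurableTypeR R]
    (fun v => (if (0 < v)%R then f0 v (xi k w) else 0%R)%:E).
  apply/measurable_EFinP; apply: measurable_fun_ifT => //.
    exact: measurable_fun_ltr.
  exact: (measurable_fun_pair1 (xi k w) measurable_ext0).
rewrite /total_excitation -(ge0_integral_subr (tau k w) mg); last first.
  by move=> s; case: ifP; rewrite lee_fin.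
rewrite /future_excitation/= -ge0_integralD//; last 2 first.
- by move=> s _; case: ifP; rewrite lee_fin.
- apply/measurable_EFinP; apply: measurable_fun_ifT => //;
  exact: measurable_fun_ltr.
apply: eq_integral => s _; rewrite /a (mpp_EFin_tau TM Tfin) lte_fin subr_gt0.
have [ts|ts] := ltP t s.
  by rewrite andbF/= add0e (le_lt_trans taut ts).
have [taus|taus] := ltP (tau k w) s; last by rewrite andbF adde0.
by rewrite andbT (lt_trans tau0 taus)/= adde0.
Qed.

End residual.

(** * Deviation bound for D^phi at a fixed time *)

Section law_of_large_numbers.
Variables (g : X -> R) (V K0 : R).
Hypothesis g_ge0 : forall x, 0 <= g x.
Hypothesis mg : measurable_fun setT g.
Hypothesis gE : forall x, (total_excitation x < +oo)%E -> total_excitation x = (g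
  x)%:E.
Hypothesis g_mean : (\int[Q]_x (g x)%:E = rho%:E)%E.
Hypothesis g_sqr : (\int[Q]_x (g x ^+ 2)%:E = V%:E)%E.
Hypothesis momentE : (\int[mu]_u (mean_excitation u * u%:E) = K0%:E)%E.
Variables (phi : X -> R) (K phiQ V3 : R).
Hypothesis mphi : measurable_fun setT phi.
Hypothesis K_ge0 : 0 <= K.
Hypothesis phiK_ge0 : forall x, 0 <= phi x + K.
Hypothesis phi_mean : (\int[Q]_x (phi x + K)%:E = (phiQ + K)%:E)%E.
Hypothesis phi_sqr : (\int[Q]_x ((phi x + K) ^+ 2)%:E = V3%:E)%E.

(** g is the true L^1 norm only where that norm is finite. A finite left side rules out an infinite
    norm at any mark observed up to t, so no exceptional null set of marks enters. *)
Lemma cumul_balance n t w : (t%:E < T n w)%E -> (residual n t w < +oo)%E ->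
  0 <= t ->
  fine (cumul_intensity n t w) + fine (residual n t w) = m * t + stopped_sum n t
    g w.
Proof.
move=> tT resy t0.
have cf := cumul_fin n t0 w.
have rf : residual n t w \is a fin_num by rewrite ge0_fin_numE// residual_ge0.
have := cumul_residual t0 tT; rewrite -{1}(fineK cf) -{1}(fineK rf) -EFinD => H.
have tm0 x : (0 <= total_excitation x)%E.
  by apply: integral_ge0 => v _; case: ifP; rewrite lee_fin.
have sfin k : (k < n.+1)%N -> (T k w <= t%:E)%E -> (total_excitation (xi k w) <
  +oo)%E.
  move=> kn Tk; rewrite ltey; apply/eqP => oo; move: H.
  rewrite (bigD1 (Ordinal kn))//= Tk oo addye ?addey//.
    by rewrite gt_eqF// (@lt_le_trans _ _ 0%E)// sume_ge0// => i _; case: ifP.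
apply: EFin_inj; rewrite H EFinD; congr (_ + _)%E.
rewrite /stopped_sum -sumEFin; apply: eq_bigr => k _; case: ifPn => // Tk.
by rewrite gE// sfin.
Qed.

(** The deterministic part, off the exceptional events. In the final factor, 1 comes from the sum of
    phi + K, K from subtracting K times the number of points, and 2 |phiQ| / (1 - rho) from
    replacing Lambda by its limit. *)
Lemma deviation_pointwise n t w (delta Sphi : R) : 0 < t -> 0 <= delta ->
  (t%:E < T n w)%E ->
  Sphi = \sum_(k < n.+1) (if (T k w <= t%:E)%E then phi (xi k w) else 0) ->
  `|stopped_sum n t (cst 1) w - 1 * fine (cumul_intensity n t w)| < delta ->
  `|stopped_sum n t g w - rho * fine (cumul_intensity n t w)| < delta ->
  `|stopped_sum n t (fun x => phi x + K) w - (phiQ + K) * fine (cumul_intensity n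
    t w)| < delta ->
  (residual n t w < delta%:E)%E ->
  `|Sphi - phiQ * (m / (1 - rho)) * t| < delta * (1 + K + 2 * `|phiQ| / (1 - rho)).
Proof.
move=> t0 delta0 tT SphiE H1 H2 H3 Hr.
have resy : (residual n t w < +oo)%E by rewrite (lt_le_trans Hr)// leey.
have B := cumul_balance tT resy (ltW t0).
have S3 : stopped_sum n t (fun x => phi x + K) w = Sphi + K * stopped_sum n t
  (cst 1) w.
  rewrite SphiE /stopped_sum mulr_sumr -big_split/=; apply: eq_bigr => k _.
  by case: ifP => _; rewrite ?mulr1// mulr0 addr0.
have r0 : 0 <= fine (residual n t w) by rewrite fine_ge0// residual_ge0.
have rd : fine (residual n t w) < delta.
  by rewrite -lte_fin fineK// ge0_fin_numE// residual_ge0.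
move: H1 H2 H3 B; rewrite S3.
set S1 := stopped_sum _ _ _ w; set Sg := stopped_sum _ _ _ w.
set L := fine (cumul_intensity n t w); set rr := fine _ in r0 rd *.
move=> H1 H2 H3 B.
have r1 : 0 < 1 - rho by rewrite subr_gt0.
have HL : `|L - m / (1 - rho) * t| <= 2 * delta / (1 - rho).
  (* The balance L + rr = m t + Sg solved for L: the deviations of Sg and of the residual are each
     at most delta. *)
  have -> : L - m / (1 - rho) * t = (Sg - rho * L - rr) / (1 - rho).
    have -> : Sg = L + rr - m * t by rewrite B; ring.
    by field; rewrite gt_eqF.
  rewrite normrM [X in _ * X]gtr0_norm ?invr_gt0// ler_pM2r ?invr_gt0//.
  rewrite (le_trans (ler_normB _ _))// (ger0_norm r0); lra.
have -> : Sphi - phiQ * (m / (1 - rho)) * t =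
   (Sphi + K * S1 - (phiQ + K) * L) - K * (S1 - 1 * L) + phiQ * (L - m / (1 -
     rho) * t).
  by ring.
apply: (le_lt_trans (ler_normD _ _)).
apply: (@le_lt_trans _ _ (`|Sphi + K * S1 - (phiQ + K) * L| + K * delta +
    `|phiQ| * (2 * delta / (1 - rho)))).
  apply: lerD; last by rewrite normrM ler_wpM2l.
  apply: (le_trans (ler_normB _ _)); rewrite lerD2l normrM (ger0_norm K_ge0).
  by rewrite ler_wpM2l// ltW.
rewrite (_ : delta * _ = delta + K * delta + `|phiQ| * (2 * delta / (1 - rho)));
  last first.
  by field; rewrite gt_eqF.
by rewrite 2!ltrD2r.
Qed.

(** Five exceptional events cover the deviation, each of probability O(1 / t). D is constrained only
    on t < T n; the complement T n <= t is one of the five. *)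
Lemma deviation_prob (eps : R) : 0 < eps -> exists A : R,
  forall (t : R) (D : Omega -> R), 0 < t -> measurable_fun setT D ->
  (forall n w, (t%:E < T n w)%E ->
     D w = \sum_(k < n.+1) (if (T k w <= t%:E)%E then phi (xi k w) else 0)) ->
  (P [set w | (eps * t <= `|D w - phiQ * (m / (1 - rho)) * t|)%R] <= (A / t)%:E)%E.
Proof.
move=> eps0.
have r1 : 0 < 1 - rho by rewrite subr_gt0.
pose c1 := m / (1 - rho).
have c10 : 0 <= c1 by rewrite divr_ge0// ltW.
pose q := 1 + K + 2 * `|phiQ| / (1 - rho).
have q0 : 0 < q.
  have : 0 <= 2 * `|phiQ| / (1 - rho) by apply: divr_ge0;
    [exact: mulr_ge0|exact: ltW].
  by rewrite /q => ?; rewrite -addrA ltr_pwDl// addr_ge0.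
(* q is the factor of [deviation_pointwise], so tolerance delta t on each event gives eps t for
   D. *)
pose delta := eps / q.
have delta0 : 0 < delta by rewrite divr_gt0.
(* In order: T n <= t; the deviations for h = 1, g and phi + K; the residual. *)
exists (c1 + c1 / delta ^+ 2 + V * c1 / delta ^+ 2 + V3 * c1 / delta ^+ 2 + c1 *
  K0 / delta).
move=> t D t0 mD DE; have t0' := ltW t0.
(* Then n + 1 >= t^2, which turns the bound c1 t / (n + 1) on P (T n <= t) into c1 / t. *)
pose n := Num.truncn (t ^+ 2).
have nt : t ^+ 2 <= n.+1%:R by rewrite ltW// truncnS_gt.
pose bad (h : X -> R) (c : R) := [set w | delta * t <= `|stopped_sum n t h w - c
  * fine (cumul_intensity n t w)|].
have mbad (h : X -> R) (c : R) : measurable_fun setT h -> measurable (bad h c).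
  move=> mh; rewrite -[X in measurable X]setTI.
  have mZ : measurable_fun setT (fun w => `|stopped_sum n t h w - c * fine
    (cumul_intensity n t w)|).
    apply: measurableT_comp => //; apply: measurable_funB.
      exact: measurable_stopped_sum.
    by apply: measurable_funM => //; exact: measurable_fine_cumul.
  by have := measurable_fun_ler (measurable_cst (delta * t)) mZ measurableT (Y :=
    [set true]); exact.
have m1 : measurable_fun [set: X] (cst (1 : R)) by exact: measurable_cst.
have m3 : measurable_fun [set: X] (fun x => phi x + K) by exact: measurable_funD.
pose A0 := [set w | (T n w <= t%:E)%E].
pose A4 := [set w | ((delta * t)%:E <= residual n t w)%E].
have mA0 : measurable A0.
  by rewrite -[X in measurable X]setTI; apply: measurable_lee => //;
    exact: (mpp_time_measurable TM).
have mA4 : measurable A4.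
  by rewrite -[X in measurable X]setTI; apply: measurable_lee => //;
    exact: measurable_residual.
have dt0 : 0 < delta * t by exact: mulr_gt0.
have dev (h : X -> R) (c v : R) : (forall x, 0 <= h x) -> measurable_fun setT h ->
    (\int[Q]_x (h x)%:E = c%:E)%E -> (\int[Q]_x (h x ^+ 2)%:E = v%:E)%E ->
    (P (bad h c) <= (v * c1 / delta ^+ 2 / t)%:E)%E.
  move=> h0 mh hc hv.
  apply: (le_trans (stopped_sum_deviation n t0' h0 mh hc hv dt0)).
  rewrite lee_fin -/c1 le_eqVlt; apply/orP; left; apply/eqP; field.
  by rewrite !gt_eqF.
have P0 : (P A0 <= (c1 / t)%:E)%E.
  apply: (le_trans (prob_time_le n t0')); rewrite lee_fin -/c1.
  by rewrite ler_pdivrMr// [leRHS]mulrAC ler_pdivlMr// -mulrA -expr2 ler_wpM2l.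
have P4 : (P A4 <= (c1 * K0 / delta / t)%:E)%E.
  have := markov_ge0 P (measurable_residual n t) (residual_ge0 n t) (ltW dt0).
  move=> /le_trans/(_ (integral_residual n t)).
  rewrite momentE -EFinM -lee_pdivlMl// -EFinM -/c1 => /le_trans; apply.
  rewrite lee_fin le_eqVlt; apply/orP; left; apply/eqP; field.
  by rewrite !gt_eqF.
have P1 : (P (bad (cst 1%R) 1%R) <= (c1 / delta ^+ 2 / t)%:E)%E.
  have := dev (cst 1) 1 1 (fun=> ler01) m1; rewrite mul1r; apply.
    exact: (integral_probability_cst Q 1%:E).
  rewrite -(integral_probability_cst Q 1%:E); apply: eq_integral => x _.
  by rewrite /= expr1n.
have P2 := dev g rho V g_ge0 mg g_mean g_sqr.
have P3 := dev _ _ _ phiK_ge0 m3 phi_mean phi_sqr.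
have mE : measurable [set w | (eps * t <= `|D w - phiQ * (m / (1 - rho)) * t|)%R].
  rewrite -[X in measurable X]setTI.
  have mZ : measurable_fun setT (fun w => `|D w - phiQ * (m / (1 - rho)) * t|).
    by apply: measurableT_comp => //; exact: measurable_funB.
  by have := measurable_fun_ler (measurable_cst (eps * t)) mZ measurableT (Y :=
    [set true]); exact.
apply: (@le_trans _ _ (P (A0 `|` bad (cst 1%R) 1%R `|` bad g rho
    `|` bad (fun x => phi x + K)%R (phiQ + K)%R `|` A4))).
  apply: le_measure; rewrite ?inE//.
    by do !apply: measurableU => //; exact: mbad.
  move=> w /= Hw;
    apply: contrapT => /not_orP[/not_orP[/not_orP[/not_orP[N0 N1] N2] N3] N4].
  move: Hw; apply/negP; rewrite -ltNge.
  rewrite (_ : eps * t = (delta * t) * q); last first.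
    by rewrite /delta; field; rewrite gt_eqF.
  apply: (@deviation_pointwise n t w) => //.
  - exact: ltW.
  - by rewrite ltNge; apply/negP.
  - by apply: DE; rewrite ltNge; apply/negP.
  - by rewrite ltNge; apply/negP.
  - by rewrite ltNge; apply/negP.
  - by rewrite ltNge; apply/negP.
  - by rewrite ltNge; apply/negP.
have U (A B : set Omega) (a b : R) : measurable A -> measurable B ->
    (P A <= a%:E)%E -> (P B <= b%:E)%E -> (P (A `|` B) <= (a + b)%:E)%E.
  by move=> mA mB Pa Pb; rewrite EFinD (le_trans (measureU2 _ mA mB))// leeD.
have mb1 := mbad _ 1 m1; have mb2 := mbad _ rho mg;
  have mb3 := mbad _ (phiQ + K) m3.
rewrite !mulrDl; apply: (U _ _ _ _ _ mA4 _ P4).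
  by apply: measurableU => //; apply: measurableU => //; exact: measurableU.
apply: (U _ _ _ _ _ mb3 _ P3); first by apply: measurableU => //;
  exact: measurableU.
by apply: (U _ _ _ _ _ mb2 _ P2); [exact: measurableU|exact: U].
Qed.

End law_of_large_numbers.

End bounded.

End hawkes.

(** * D^phi as an integral against the point measure *)

Section mark_integrals.
Context (R : realType) (d dX : measure_display).
Context (Omega : measurableType d) (X : measurableType dX).
Context (T : nat -> Omega -> \bar R) (M : nat -> Omega -> option X).
Hypothesis TM : marked_point_process T M.

Lemma integral_point_measure_mark (h : X -> \bar R) t w :
  measurable_fun setT h -> (forall x, 0 <= h x)%E ->
  (\int[point_measure T M w]_(z in `]0%R, t]%classic `*` setT) h z.2 =
   mark_sum T M h t w)%E.
Proof.
move=> mh h0;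
  have mD : measurable (`]0%R, t]%classic `*` setT : set (measurableTypeR R * X)).
  by apply: measurableX => //; exact: measurable_itv.
rewrite (integral_point_measure TM)//; last first.
  by apply: measurable_funTS; apply: (measurableT_comp mh); exact: measurable_snd.
apply: eq_eseriesr => k _.
by rewrite in_setX in_setT andbT (mpp_le_itv TM).
Qed.

Lemma measurable_mark_sum (h : X -> \bar R) t :
  measurable_fun setT h -> (forall x, 0 <= h x)%E ->
  measurable_fun setT (mark_sum T M h t).
Proof.
move=> mh h0; apply: ge0_emeasurable_sum => k; first by move=> w _ _; case: ifP.
move=> _; apply: measurable_fun_ifT => //.
  by apply: measurable_fun_lee => //; exact: (mpp_time_measurable TM).
exact: (measurableT_comp mh (measurable_xi TM k)).
Qed.

Lemma mark_sum_finite (h : X -> \bar R) t w n : (forall x, 0 <= h x)%E ->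
  (t%:E < T n w)%E ->
  (mark_sum T M h t w =
   \sum_(k < n.+1) if T k w <= t%:E then h (xi M k w) else 0)%E.
Proof.
move=> h0 tT; apply: nneseries_finite; first by move=> k; case: ifP.
move=> k nk; rewrite ifF//; apply/negbTE; rewrite -ltNge.
by rewrite (lt_le_trans tT)// (mpp_le_mono TM)// ltnW.
Qed.

(** Infinitely many points before t are not excluded path by path. The [fine] of a difference of two
    non-negative series is measurable in w in every case, and becomes a finite sum where t < T n. *)
Lemma Rintegral_point_measure_markE (h : X -> R) t w : measurable_fun setT h ->
  \int[point_measure T M w]_(z in `]0, t]%classic `*` setT) h z.2 =
  fine (mark_sum T M (EFin \o h)^\+%E t w - mark_sum T M (EFin \o h)^\-%E t w).
Proof.
move=> mh; rewrite /Rintegral integralE.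
have mhE : measurable_fun setT (EFin \o h) by exact/measurable_EFinP.
congr (fine (_ - _)).
  rewrite -integral_point_measure_mark; [|exact: measurable_funepos|by []].
  by apply: eq_integral => z _; rewrite !funeposE.
rewrite -integral_point_measure_mark; [|exact: measurable_funeneg|by []].
by apply: eq_integral => z _; rewrite !funenegE.
Qed.

Lemma measurable_Rintegral_mark (h : X -> R) t : measurable_fun setT h ->
  measurable_fun setT (fun w =>
    \int[point_measure T M w]_(z in `]0, t]%classic `*` setT) h z.2).
Proof.
move=> mh; have mhE : measurable_fun setT (EFin \o h) by exact/measurable_EFinP.
under eq_fun do rewrite Rintegral_point_measure_markE//.
apply: measurableT_comp => //; apply: emeasurable_funB.
  by apply: measurable_mark_sum => //; exact: measurable_funepos.
by apply: measurable_mark_sum => //; exact: measurable_funeneg.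
Qed.

Lemma Rintegral_mark_finite (h : X -> R) t w n : measurable_fun setT h ->
  (t%:E < T n w)%E ->
  \int[point_measure T M w]_(z in `]0, t]%classic `*` setT) h z.2 =
  \sum_(k < n.+1) if (T k w <= t%:E)%E then h (xi M k w) else 0.
Proof.
move=> mh tT; rewrite Rintegral_point_measure_markE// !(mark_sum_finite _ tT)//.
pose a (u : R -> R) := \sum_(k < n.+1) if (T k w <= t%:E)%E then u (h (xi M k w))
  else 0.
rewrite [X in (X - _)%E](_ : _ = (a (Num.max ^~ 0))%:E); last first.
  rewrite /a -sumEFin; apply: eq_bigr => k _; rewrite funeposE /= -EFin_max.
  by case: ifP.
rewrite [X in (_ - X)%E](_ : _ = (a (fun x => Num.max (- x) 0))%:E); last first.
  rewrite /a -sumEFin; apply: eq_bigr => k _; rewrite funenegE /= -EFin_max.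
  by case: ifP.
rewrite /= /a -sumrB; apply: eq_bigr => k _; case: ifP => _; last by rewrite subr0.
by case: (leP 0 (h (xi M k w))) => h0; [rewrite (max_idPr _) ?subr0 ?oppr_le0|
  rewrite (max_idPl _) ?sub0r ?opprK ?oppr_ge0 ?ltW].
Qed.

End mark_integrals.

(** * Convergence in probability *)

Lemma cvg_in_probability_rate (R : realType) (d : measure_display)
    (Omega : measurableType d) (P : probability Omega R)
    (Y : R -> Omega -> R) (c : R) :
  (forall eps, 0 < eps -> exists A : R, forall S, 0 < S ->
    (P [set w | (eps <= `|Y S w - c|)%R] <= (A / S)%:E)%E) ->
  cvg_in_probability P Y c.
Proof.
move=> H eps eps0; have [A PA] := H _ eps0.
apply: (@squeeze_cvge _ _ _ _ (cst 0%E) _ (fun S : R => (A / S)%:E)).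
- apply: filterS (nbhs_pinfty_gt (num_real (0 : R))) => S S0.
  by rewrite measure_ge0/= PA.
- exact: cvg_cst.
- apply: cvg_EFin; first exact: nearW.
  rewrite -(mulr0 A); apply: cvgMl_tmp; apply/gtr0_cvgV0 => //.
  by apply: nbhs_pinfty_gt; exact: num_real.
Qed.

Theorem theorem4p6 (R : realType) (d dX : measure_display)
    (Omega : measurableType d) (X : measurableType dX)
    (hX : borel_space R X)
    (P : probability Omega R) (Q : probability X R)
    (m : R) (m_ge0 : 0 <= m)
    (f : R -> X -> R)
    (f_ge0 : forall (t : R) x, 0 <= t -> 0 <= f t x)
    (f_bounded : exists C : R, forall (t : R) x, 0 <= t -> f t x <= C)
    (f_measurable : measurable_fun
       (`[0, +oo[%classic `*` setT : set (measurableTypeR R * X))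
       (fun z : measurableTypeR R * X => f z.1 z.2))
    (f_L1_square : (\int[Q]_x (L1_norm (f ^~ x)) ^+ 2 < +oo)%E)
    (T : nat -> Omega -> \bar R) (M : nat -> Omega -> option X)
    (hN : marked_hawkes P Q m f T M)
    (F : R -> R) (hF : forall t : R, 0 <= t -> F t = \int[Q]_x f t x)
    (F_L1 : (L1_norm F < 1)%E)
    (F_moment : (\int[lebesgue_measure]_(t in `[0%R, +oo[)
                   (t * F t)%:E < +oo)%E)
    (r : R -> R) (hr : resolvent_opp F r)
    (Res : R -> R) (hRes : forall t : R, 0 <= t -> Res t = - r t)
    (phi : X -> R) (phi_measurable : measurable_fun setT phi)
    (phi_bounded : exists C : R, forall x, `|phi x| <= C)
    (hsq : (\int[Q]_x
              (\int[lebesgue_measure]_(u in `[0%R, +oo[)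
                 (f u x + convol Res (f ^~ x) u)%:E) ^+ 2 < +oo)%E)
    (D : R -> Omega -> R)
    (hD : forall (t : R) w, 0 <= t ->
       D t w = \int[point_measure T M w]_(z in `]0, t]%classic `*` setT)
                 phi z.2)
    (psi : R -> R)
    (hpsi : forall v : R, 0 <= v ->
       psi v = (\int[Q]_x phi x) * v * m * (fine (L1_norm Res) + 1)) :
  forall v : R, 0 <= v ->
    cvg_in_probability P (fun S w => D (v * S) w / S) (psi v).
Proof.
have [TM [kappa N_kappa kappaE]] := hN.
have [C fC] := f_bounded.
have C0 : 0 <= C by rewrite (le_trans (f_ge0 0 point (lexx 0)))// fC.
pose mu := @lebesgue_measure R.
have f0_ge0 : forall t x, 0 <= ext0 f t x := ext0_ge0 f_ge0.
have mf0 := measurable_ext0 f_measurable.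
have mF := measurable_mean_excitation Q f_ge0 f_measurable.
have mF0 s := mean_excitation_ge0 Q f_ge0 s.
have mF_lt0 u : u < 0 -> mean_excitation Q f u = 0%E by exact: mean_excitation_lt0.
have mF_le s : (mean_excitation Q f s <= C%:E)%E.
  rewrite -(integral_probability_cst Q C%:E); apply: ge0_le_integral => //.
  - by move=> x _; rewrite lee_fin.
  - by apply/measurable_EFinP; exact: (measurable_fun_pair2 s mf0).
  - by move=> x _; rewrite lee_fin /ext0; case: ifP => // /fC.
have mF_fin s : mean_excitation Q f s \is a fin_num.
  by rewrite ge0_fin_numE// (le_lt_trans (mF_le s)) ?ltry.
have FE s : 0 <= s -> (F s)%:E = mean_excitation Q f s.
  move=> s0; rewrite hF// -(fineK (mF_fin s)); congr EFin.
  by apply: eq_Rintegral => x _; rewrite /ext0 s0.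
have L1F : (L1_norm F = \int[mu]_s mean_excitation Q f s)%E.
  rewrite /L1_norm integral_mkcond; apply: eq_integral => s _.
  rewrite /patch mem_setE in_itv/= andbT; case: (leP 0 s) => s0;
    last by rewrite mF_lt0.
  by rewrite -abse_EFin FE// gee0_abs.
have rho_fin : (\int[mu]_s mean_excitation Q f s)%E \is a fin_num.
  by rewrite ge0_fin_numE;
    [rewrite -L1F (lt_trans F_L1)// ltry|exact: integral_ge0].
pose rho := fine (\int[mu]_s mean_excitation Q f s)%E.
have rhoE : (\int[mu]_s mean_excitation Q f s = rho%:E)%E by rewrite fineK.
have rho1 : rho < 1 by rewrite -lte_fin -rhoE -L1F.
have r1 : 1 - rho != 0 by rewrite gt_eqF// subr_gt0.
have ResE : fine (L1_norm Res) + 1 = (1 - rho)^-1.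
  have [r_int req] := hr.
  (* F is prescribed only on t >= 0; [F0] agrees with it there and vanishes before, as the resolvent
     section requires. *)
  pose F0 s := fine (mean_excitation Q f s).
  have F0E s : 0 <= s -> F0 s = F s by move=> s0; rewrite /F0 -FE.
  have -> : L1_norm Res = (rho / (1 - rho))%:E.
    apply: (@L1_norm_resolvent R F0 C rho _ _ _ _ _ rho1 r) => //.
    - by move=> s; exact: fine_ge0.
    - by move=> s s0; rewrite /F0 mF_lt0.
    - by move=> s; rewrite -lee_fin fineK.
    - exact: measurableT_comp.
    - by rewrite -rhoE; apply: eq_integral => s _; rewrite fineK.
    - move=> t t0; rewrite req// F0E//; congr (_ - _).
      apply: eq_Rintegral => s; rewrite inE/= in_itv/= => /andP[_ st].
      by rewrite F0E// subr_ge0.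
  by rewrite /=; field.
have K0_fin : (\int[mu]_u (mean_excitation Q f u * u%:E))%E \is a fin_num.
  have E : (\int[mu]_u (mean_excitation Q f u * u%:E) =
      \int[mu]_(t in `[0%R, +oo[) (t * F t)%:E)%E.
    rewrite [RHS]integral_mkcond; apply: eq_integral => s _.
    rewrite /patch mem_setE in_itv/= andbT; case: (leP 0 s) => s0;
      last by rewrite mF_lt0// mul0e.
    by rewrite EFinM FE// muleC.
  rewrite ge0_fin_numE ?E//; apply: integral_ge0 => t;
    rewrite /= in_itv/= andbT => t0.
  by rewrite EFinM FE// mule_ge0.
pose tm := total_excitation f.
have mk : measurable_fun [set: X * measurableTypeR R]
    (fun z => (if 0 < z.2 then ext0 f z.2 z.1 else 0)%:E).
  apply/measurable_EFinP; apply: measurable_fun_ifT => //.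
    by apply: measurable_fun_ltr => //; exact: measurable_snd.
  apply: (measurableT_comp mf0
    (g := fun z : X * measurableTypeR R => (z.2, z.1) : measurableTypeR R * X)).
  by apply: measurable_fun_pair; [exact: measurable_snd|exact: measurable_fst].
have k0 (z : X * measurableTypeR R) : (0 <= (if 0 < z.2 then ext0 f z.2 z.1 else
  0)%:E)%E.
  by rewrite lee_fin; case: ifP.
have mtm : measurable_fun setT tm.
  exact: (measurable_fun_fubini_tonelli_F (m2 := mu) _ mk).
have tm0 x : (0 <= tm x)%E by apply: integral_ge0 => v _; exact: (k0 (x, v)).
have tmL1 x : tm x = L1_norm (f ^~ x).
  rewrite /L1_norm -integral_itv_obnd_cbnd; last first.
    apply: measurableT_comp => //; apply/measurable_EFinP.
    apply: eq_measurable_fun (measurable_funTS (measurable_fun_pair1 x mf0)) => s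
      /=.
    rewrite inE/= in_itv/= andbT => s0.
    by rewrite /ext0 ltW.
  rewrite integral_mkcond; apply: eq_integral => s _.
  rewrite /patch mem_setE in_itv/= andbT; case: ifP => // s0.
  by rewrite /ext0 ltW// ger0_norm// f_ge0// ltW.
have int_tm : (\int[Q]_x tm x = rho%:E)%E.
  rewrite /tm /total_excitation (fubini_tonelli (m1 := Q) (m2 := mu) _ mk k0)/=
    -rhoE.
  (* At s = 0 the inner integral is 0 by the strict condition 0 < s, while [mean_excitation Q f 0]
     need not be; the correction at this single point is null. *)
  have md : measurable_fun [set: measurableTypeR R]
      (fun s => if s == 0 then mean_excitation Q f s else 0%E).
    by apply: measurable_fun_ifT => //; exact: measurable_fun_eqr.
  rewrite -[LHS]adde0 -(integral_lebesgue_diag 0 (mean_excitation Q f))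
    -ge0_integralD//.
  - apply: eq_integral => s _; case: (ltgtP 0 s) => [s0|s0|<-].
    + by rewrite adde0.
    + by rewrite mF_lt0// integral0// adde0.
    + by rewrite integral0// add0e.
  - by move=> s _; apply: integral_ge0 => x _; exact: (k0 (x, s)).
  - exact: (measurable_fun_fubini_tonelli_G (m1 := Q) _ mk).
  - by move=> s _; case: ifP.
(* An infinite norm is sent to 0; since [tm] has finite integral rho, this happens on a Q-null set
   only and the moments are not affected. *)
pose g x := fine (tm x).
have mg : measurable_fun setT g by exact: measurableT_comp.
have g0 x : 0 <= g x by exact: fine_ge0.
have gE x : (tm x < +oo)%E -> tm x = (g x)%:E by move=> xy;
  rewrite fineK// ge0_fin_numE.
have g_mean : (\int[Q]_x (g x)%:E = rho%:E)%E.
  rewrite -int_tm; apply: ge0_ae_eq_integral => //.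
  - exact/measurable_EFinP.
  - by move=> x _; rewrite lee_fin.
  have : Q.-integrable setT tm.
    apply/integrableP; split => //; under eq_integral do rewrite gee0_abs//.
    by rewrite int_tm ltry.
  move=> /integrable_ae => /(_ measurableT); apply: filterS => x H _.
  by rewrite fineK// H.
have g_sqr : (\int[Q]_x (g x ^+ 2)%:E)%E \is a fin_num.
  rewrite ge0_fin_numE; last by apply: integral_ge0 => x _; rewrite lee_fin sqr_ge0.
  apply: le_lt_trans f_L1_square; apply: ge0_le_integral => //.
  - by move=> x _; rewrite lee_fin sqr_ge0.
  - by apply/measurable_EFinP; exact: measurable_funX.
  - under eq_fun do rewrite -tmL1; exact: emeasurable_funM.
  - move=> x _; rewrite -tmL1; have [/gE ->//|] := ltP (tm x) +oo%E.
    by rewrite leye_eq /g => /eqP ->; rewrite /= expr0n/= leey.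
(* Adding the bound K makes phi non-negative, as the compensator formula requires. *)
have [K phiK] := phi_bounded.
have K0 : 0 <= K by rewrite (le_trans (normr_ge0 _) (phiK point)).
have phiK0 x : 0 <= phi x + K.
  by have := ler_norm (- phi x); rewrite normrN; have := phiK x; lra.
have Qfin : (Q setT < +oo)%E by rewrite [X in (X < _)%E](probability_setT Q) ltry.
have phi_int : Q.-integrable setT (EFin \o phi).
  apply: measurable_bounded_integrable => //.
  by exists K; split; [exact: num_real|move=> y Ky x _;
    rewrite /= (le_trans (phiK x))// ltW].
pose phiQ := \int[Q]_x phi x.
have phi_mean : (\int[Q]_x (phi x + K)%:E = (phiQ + K)%:E)%E.
  under eq_integral do rewrite EFinD.
  rewrite integralD_EFin//; last exact: finite_measure_integrable_cst.
  rewrite [X in (_ + X)%E](integral_probability_cst Q K%:E) EFinD; congr (_ + _)%E.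
  by rewrite fineK// integrable_fin_num.
have phi_sqr : (\int[Q]_x ((phi x + K) ^+ 2)%:E)%E \is a fin_num.
  rewrite ge0_fin_numE; last by apply: integral_ge0 => x _; rewrite lee_fin sqr_ge0.
  apply: (@le_lt_trans _ _ ((K + K) ^+ 2)%:E); last by rewrite ltry.
  rewrite -(integral_probability_cst Q ((K + K) ^+ 2)%:E);
    apply: ge0_le_integral => //.
  - by move=> x _; rewrite lee_fin sqr_ge0.
  - by apply/measurable_EFinP; apply: measurable_funX; exact: measurable_funD.
  - move=> x _;
    have xK : phi x + K <= K + K by rewrite lerD2r (le_trans (ler_norm _)).
    by rewrite lee_fin ler_pXn2r// nnegrE// addr_ge0.
move=> v v0; apply: cvg_in_probability_rate => eps eps0.
(* The deviation bound needs a positive time; for v = 0 both D and psi are 0. *)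
have [->|vn0] := eqVneq v 0.
  exists 0 => S S0; rewrite [X in P X](_ : _ = set0);
    first by rewrite measure0 mul0r.
  apply/seteqP; split => // w /=; rewrite mul0r hpsi// mulr0 !mul0r subr0 hD//.
  rewrite set_itvoc0 set0X /Rintegral integral_set0 /= mul0r normr0.
  by rewrite leNgt eps0.
have vp : 0 < v by rewrite lt_neqAle eq_sym vn0.
(* At time t = v S a deviation of D / S by eps is one of D by eps S = (eps / v) t, so the bound is
   used with eps / v, and A / t = (A / v) / S. *)
have ev0 : 0 < eps / v by rewrite divr_gt0.
have [A HA] := deviation_prob m_ge0 f_ge0 f_measurable TM N_kappa kappaE C0 fC
  rhoE rho1 g0 mg gE g_mean (esym (fineK g_sqr)) (esym (fineK K0_fin))
  phi_measurable K0 phiK0 phi_mean (esym (fineK phi_sqr)) ev0.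
exists (A / v) => S S0.
have t0 : 0 < v * S by exact: mulr_gt0.
have mD : measurable_fun setT (D (v * S)).
  rewrite (_ : D (v * S) = fun w =>
    \int[point_measure T M w]_(z in `]0, v * S]%classic `*` setT) phi z.2).
    exact: measurable_Rintegral_mark.
  by apply/funext => w; rewrite hD// ltW.
have DE n w : ((v * S)%:E < T n w)%E -> D (v * S) w =
    \sum_(k < n.+1) if (T k w <= (v * S)%:E)%E then phi (xi M k w) else 0.
  by move=> tT; rewrite hD ?ltW//; exact: Rintegral_mark_finite.
have := HA _ _ t0 mD DE.
rewrite (_ : A / (v * S) = A / v / S); last by rewrite invfM mulrA.
have EE w : (eps <= `|D (v * S) w / S - psi v|) =
    (eps / v * (v * S) <= `|D (v * S) w - phiQ * (m / (1 - rho)) * (v * S)|).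
  rewrite hpsi// ResE -/phiQ.
  rewrite (_ : _ / S - _ = (D (v * S) w - phiQ * (m / (1 - rho)) * (v * S)) / S).
    rewrite normrM (gtr0_norm (x := S^-1)) ?invr_gt0// ler_pdivlMr//.
    by rewrite (_ : eps / v * (v * S) = eps * S)// mulrA divfK.
  by field; rewrite r1 gt_eqF.
apply: le_trans; rewrite le_eqVlt; apply/orP; left; apply/eqP; congr (P _).
by apply/seteqP; split => w /=; rewrite EE.
Qed.
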